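(* Let $0\le n\le\infty$. The monoidal categories $\mathrm{Aut}(n\text{-}\mathrm{Cat})$ and $\mathrm{Aut}(n\text{-}\mathrm{Cat}_{\mathrm r})$ are equivalent to the discrete monoidal category $((\mathbf Z/2\mathbf Z)^n)_{\mathrm{disc}}$, where $n\text{-}\mathrm{Cat}$ is the category of strict $n$-categories and $n\text{-}\mathrm{Cat}_{\mathrm r}$ is the category of rigid strict $n$-categories.
   Context: Set-theoretic size issues are neglected. For a category $\mathcal C$, $\mathrm{Aut}(\mathcal C)$ is the category of autoequivalences of $\mathcal C$ (full subcategory, on the equivalences, of the category of endofunctors and natural transformations), with strict monoidal structure given by composition. For $n=\infty$, $(\mathbf Z/2\mathbf Z)^\infty=\prod_{k\ge1}\mathbf Z/2\mathbf Z$. $((\mathbf Z/2\mathbf Z)^n)_{\mathrm{disc}}$ is the discrete category on this set, with strict monoidal structure given by the group law. $n\text{-}\mathrm{Cat}$ is the category of small strict $n$-categories and strict $n$-functors. A $k$-arrow $u:x\to y$ between $(k-1)$-arrows is strictly invertible if there is a $k$-arrow $v:y\to x$ with $vu=1_x$ and $uv=1_y$ (composition along $(k-1)$-arrows). A strict $n$-category is rigid if for every $k$ with $1\le k\le n$, every strictly invertible $k$-arrow is the identity of a $(k-1)$-arrow. $n\text{-}\mathrm{Cat}_{\mathrm r}$ is the full subcategory of $n\text{-}\mathrm{Cat}$ on the rigid strict $n$-categories. *)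

(* Defs.v *)
From mathcomp Require Import all_boot all_algebra.
From mathcomp Require Import boolp functions.

Set Implicit Arguments.
Unset Strict Implicit.
Unset Printing Implicit Defensive.

Declare Scope cat_scope.
Delimit Scope cat_scope with C.
Local Open Scope cat_scope.

Record category := Category {
  obj :> Type;
  hom : obj -> obj -> Type;
  idm : forall a, hom a a;
  cmp : forall a b c, hom b c -> hom a b -> hom a c;
  cmp1m : forall a b (f : hom a b), cmp (idm b) f = f;
  cmpm1 : forall a b (f : hom a b), cmp f (idm a) = f;
  cmpA : forall a b c d (h : hom c d) (g : hom b c) (f : hom a b),
    cmp h (cmp g f) = cmp (cmp h g) f
}.
Arguments hom {_}.
Arguments idm {_}.

Notation "g \o f" := (cmp g f) : cat_scope.

Definition is_iso (C : category) (a b : C) (f : hom a b) : Prop :=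
  exists g : hom b a, g \o f = idm a /\ f \o g = idm b.

Definition isomorphic (C : category) (a b : C) : Prop :=
  exists f : hom a b, is_iso f.

Record functor (C D : category) := Functor {
  fobj :> C -> D;
  fmap : forall a b, hom a b -> hom (fobj a) (fobj b);
  fmap1 : forall a, fmap (idm a) = idm (fobj a);
  fmapM : forall a b c (g : hom b c) (f : hom a b),
    fmap (g \o f) = fmap g \o fmap f
}.
Arguments fmap {_ _} _ {_ _}.

Definition functor_id (C : category) : functor C C :=
  @Functor C C (fun a => a) (fun a b f => f)
    (fun=> erefl) (fun _ _ _ _ _ => erefl).

Section FunctorComp.
Variables (C D E : category) (G : functor D E) (F : functor C D).

Lemma functor_comp1 a : fmap G (fmap F (idm a)) = idm (G (F a)).
Proof. by rewrite !fmap1. Qed.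

Lemma functor_compM a b c (g : hom b c) (f : hom a b) :
  fmap G (fmap F (g \o f)) = fmap G (fmap F g) \o fmap G (fmap F f).
Proof. by rewrite !fmapM. Qed.

Definition functor_comp : functor C E :=
  @Functor C E (fun a => G (F a)) (fun a b f => fmap G (fmap F f))
    functor_comp1 functor_compM.
End FunctorComp.

Record nat_trans (C D : category) (F G : functor C D) := NatTrans {
  ncomp :> forall a, hom (F a) (G a);
  ncomp_nat : forall a b (f : hom a b),
    fmap G f \o ncomp a = ncomp b \o fmap F f
}.

Lemma nat_transP (C D : category) (F G : functor C D) (s t : nat_trans F G) :
  (forall a, s a = t a) -> s = t.
Proof.
case: s t => s sn [t tn] /= st.
have {}st : s = t by apply: functional_extensionality_dep.
by case: t / st tn => tn; congr NatTrans; apply: Prop_irrelevance.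
Qed.

Section FunctorCategory.
Variables C D : category.

Lemma nat_id_nat (F : functor C D) a b (f : hom a b) :
  fmap F f \o idm (F a) = idm (F b) \o fmap F f.
Proof. by rewrite cmp1m cmpm1. Qed.

Definition nat_id (F : functor C D) : nat_trans F F :=
  NatTrans (@nat_id_nat F).

Lemma nat_cmp_nat (F G H : functor C D) (t : nat_trans G H)
    (s : nat_trans F G) a b (f : hom a b) :
  fmap H f \o (t a \o s a) = (t b \o s b) \o fmap F f.
Proof. by rewrite cmpA ncomp_nat -cmpA ncomp_nat cmpA. Qed.

Definition nat_cmp (F G H : functor C D) (t : nat_trans G H)
    (s : nat_trans F G) : nat_trans F H :=
  NatTrans (nat_cmp_nat t s).

Definition functor_category : category.
Proof.
refine (@Category (functor C D) (@nat_trans C D) nat_id nat_cmp _ _ _).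
- by move=> F G s; apply: nat_transP => a; apply: cmp1m.
- by move=> F G s; apply: nat_transP => a; apply: cmpm1.
- by move=> F G H K u t s; apply: nat_transP => a; apply: cmpA.
Defined.
End FunctorCategory.

Definition is_equivalence (C D : category) (F : functor C D) : Prop :=
  exists G : functor D C,
    @isomorphic (functor_category C C) (functor_comp G F) (functor_id C) /\
    @isomorphic (functor_category D D) (functor_comp F G) (functor_id D).

Definition full_subcategory (C : category) (P : C -> Prop) : category :=
  @Category {a : C | P a} (fun a b => hom (sval a) (sval b))
    (fun a => idm (sval a)) (fun a b c g f => g \o f)
    (fun a b f => cmp1m f) (fun a b f => cmpm1 f)
    (fun a b c d h g f => cmpA h g f).

Record monoidal_category := MonoidalCategory {
  mcat :> category;
  tens : mcat -> mcat -> mcat;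
  tensm : forall a a' b b' : mcat,
    hom a a' -> hom b b' -> hom (tens a b) (tens a' b');
  munit : mcat;
  massoc : forall a b c, hom (tens (tens a b) c) (tens a (tens b c));
  munitl : forall a, hom (tens munit a) a;
  munitr : forall a, hom (tens a munit) a;
  tensm1 : forall a b, tensm (idm a) (idm b) = idm (tens a b);
  tensmM : forall a a' a'' b b' b'' (f' : hom a' a'') (f : hom a a')
      (g' : hom b' b'') (g : hom b b'),
    tensm (f' \o f) (g' \o g) = tensm f' g' \o tensm f g;
  massoc_nat : forall a a' b b' c c' (f : hom a a') (g : hom b b')
      (h : hom c c'),
    tensm f (tensm g h) \o massoc a b c =
    massoc a' b' c' \o tensm (tensm f g) h;
  munitl_nat : forall a a' (f : hom a a'),
    f \o munitl a = munitl a' \o tensm (idm munit) f;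
  munitr_nat : forall a a' (f : hom a a'),
    f \o munitr a = munitr a' \o tensm f (idm munit);
  massoc_iso : forall a b c, is_iso (massoc a b c);
  munitl_iso : forall a, is_iso (munitl a);
  munitr_iso : forall a, is_iso (munitr a);
  pentagon : forall a b c d,
    massoc a b (tens c d) \o massoc (tens a b) c d =
    tensm (idm a) (massoc b c d) \o
      (massoc a (tens b c) d \o tensm (massoc a b c) (idm d));
  triangle : forall a b,
    tensm (idm a) (munitl b) \o massoc a munit b = tensm (munitr a) (idm b)
}.
Arguments munit {_}.

Record strong_monoidal_functor (A B : monoidal_category) :=
  StrongMonoidalFunctor {
  mfun :> functor A B;
  mfmul : forall a b : A, hom (tens (mfun a) (mfun b)) (mfun (tens a b));
  mfone : hom munit (mfun munit);
  mfmul_iso : forall a b, is_iso (mfmul a b);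
  mfone_iso : is_iso mfone;
  mfmul_nat : forall (a a' b b' : A) (f : hom a a') (g : hom b b'),
    fmap mfun (tensm f g) \o mfmul a b =
    mfmul a' b' \o tensm (fmap mfun f) (fmap mfun g);
  mfmulA : forall a b c : A,
    fmap mfun (massoc a b c) \o
      (mfmul (tens a b) c \o tensm (mfmul a b) (idm (mfun c))) =
    mfmul a (tens b c) \o
      (tensm (idm (mfun a)) (mfmul b c) \o
        massoc (mfun a) (mfun b) (mfun c));
  mfmul1l : forall a : A,
    fmap mfun (munitl a) \o (mfmul munit a \o tensm mfone (idm (mfun a))) =
    munitl (mfun a);
  mfmul1r : forall a : A,
    fmap mfun (munitr a) \o (mfmul a munit \o tensm (idm (mfun a)) mfone) =
    munitr (mfun a)
}.

Definition monoidally_equivalent (A B : monoidal_category) : Prop :=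
  exists F : strong_monoidal_functor A B, is_equivalence F.

Definition full_monoidal_subcategory (A : monoidal_category) (P : A -> Prop)
  (P1 : P munit) (PM : forall a b, P a -> P b -> P (tens a b)) :
  monoidal_category :=
  @MonoidalCategory (full_subcategory P)
    (fun a b => exist P _ (PM _ _ (svalP a) (svalP b)))
    (fun a a' b b' f g => tensm f g)
    (exist P _ P1)
    (fun a b c => massoc (sval a) (sval b) (sval c))
    (fun a => munitl (sval a)) (fun a => munitr (sval a))
    (fun a b => tensm1 (sval a) (sval b))
    (fun a a' a'' b b' b'' f' f g' g => tensmM f' f g' g)
    (fun a a' b b' c c' f g h => massoc_nat f g h)
    (fun a a' f => munitl_nat f) (fun a a' f => munitr_nat f)
    (fun a b c => massoc_iso (sval a) (sval b) (sval c))
    (fun a => munitl_iso (sval a)) (fun a => munitr_iso (sval a))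
    (fun a b c d => pentagon (sval a) (sval b) (sval c) (sval d))
    (fun a b => triangle (sval a) (sval b)).

Section HorizontalComp.
Variables (C D E : category) (G G' : functor D E) (F F' : functor C D).
Variables (t : nat_trans G G') (s : nat_trans F F').

Lemma hcomp_nat a b (f : hom a b) :
  fmap (functor_comp G' F') f \o (fmap G' (s a) \o t (F a)) =
  (fmap G' (s b) \o t (F b)) \o fmap (functor_comp G F) f.
Proof.
by rewrite cmpA -fmapM ncomp_nat fmapM -!cmpA; congr (_ \o _); rewrite ncomp_nat.
Qed.

Definition hcomp : nat_trans (functor_comp G F) (functor_comp G' F') :=
  @NatTrans C E (functor_comp G F) (functor_comp G' F')
    (fun a => fmap G' (s a) \o t (F a)) hcomp_nat.
End HorizontalComp.

(* Composition of functors is strictly associative and unital, so the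
   components of the structural isomorphisms are identities. *)
Section Endofunctors.
Variable C : category.
Let E := functor_category C C.

Definition end_assoc (F G H : E) :
  nat_trans (functor_comp (functor_comp F G) H)
            (functor_comp F (functor_comp G H)) :=
  @NatTrans C C (functor_comp (functor_comp F G) H)
    (functor_comp F (functor_comp G H))
    (fun a => idm (F (G (H a)))) (@nat_id_nat C C _).

Definition end_unitl (F : E) : nat_trans (functor_comp (functor_id C) F) F :=
  @NatTrans C C (functor_comp (functor_id C) F) F
    (fun a => idm (F a)) (@nat_id_nat C C F).

Definition end_unitr (F : E) : nat_trans (functor_comp F (functor_id C)) F :=
  @NatTrans C C (functor_comp F (functor_id C)) F
    (fun a => idm (F a)) (@nat_id_nat C C F).

Definition end_assocV (F G H : E) :
  nat_trans (functor_comp F (functor_comp G H))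
            (functor_comp (functor_comp F G) H) :=
  @NatTrans C C (functor_comp F (functor_comp G H))
    (functor_comp (functor_comp F G) H)
    (fun a => idm (F (G (H a)))) (@nat_id_nat C C _).

Definition end_unitlV (F : E) : nat_trans F (functor_comp (functor_id C) F) :=
  @NatTrans C C F (functor_comp (functor_id C) F)
    (fun a => idm (F a)) (@nat_id_nat C C F).

Definition end_unitrV (F : E) : nat_trans F (functor_comp F (functor_id C)) :=
  @NatTrans C C F (functor_comp F (functor_id C))
    (fun a => idm (F a)) (@nat_id_nat C C F).

Definition endofunctors : monoidal_category.
Proof.
refine (@MonoidalCategory E (fun F G => functor_comp F G)
  (fun F F' G G' s t => hcomp s t) (functor_id C)
  end_assoc end_unitl end_unitr _ _ _ _ _ _ _ _ _ _).
- by move=> F G; apply: nat_transP => a /=; rewrite fmap1 cmp1m.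
- move=> F F' F'' G G' G'' f' f g' g; apply: nat_transP => a /=.
  by rewrite fmapM -!cmpA; congr (_ \o _); rewrite !cmpA ncomp_nat.
- move=> F F' G G' H H' f g h; apply: nat_transP => a /=.
  by rewrite cmpm1 cmp1m fmapM -!cmpA.
- by move=> F F' f; apply: nat_transP => a /=; rewrite !cmpm1 cmp1m.
- by move=> F F' f; apply: nat_transP => a /=; rewrite fmap1 cmpm1 !cmp1m.
- by move=> F G H; exists (end_assocV F G H); split; apply: nat_transP => a /=;
    rewrite cmp1m.
- by move=> F; exists (end_unitlV F); split; apply: nat_transP => a /=;
    rewrite cmp1m.
- by move=> F; exists (end_unitrV F); split; apply: nat_transP => a /=;
    rewrite cmp1m.
- by move=> F G H K; apply: nat_transP => a /=; rewrite !fmap1 !cmp1m.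
- by move=> F G; apply: nat_transP => a /=; rewrite !fmap1 !cmp1m.
Defined.
End Endofunctors.

Section EquivalenceComp.
Variable C : category.

Lemma isomorphic_tens (A : monoidal_category) (a a' b b' : A) :
  isomorphic a a' -> isomorphic b b' -> isomorphic (tens a b) (tens a' b').
Proof.
move=> [f [f' [f'f ff']]] [g [g' [g'g gg']]].
by exists (tensm f g), (tensm f' g');
  rewrite -!tensmM f'f ff' g'g gg' !tensm1.
Qed.

Lemma isomorphic_trans (D : category) (a b c : D) :
  isomorphic a b -> isomorphic b c -> isomorphic a c.
Proof.
move=> [f [f' [f'f ff']]] [g [g' [g'g gg']]]; exists (g \o f), (f' \o g').
split; first by rewrite cmpA -(cmpA f') g'g cmpm1.
by rewrite cmpA -(cmpA g) ff' cmpm1.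
Qed.

Lemma isomorphic_sym (D : category) (a b : D) :
  isomorphic a b -> isomorphic b a.
Proof. by move=> [f [f' [f'f ff']]]; exists f', f. Qed.

Lemma isomorphic_refl (D : category) (a : D) : isomorphic a a.
Proof. by exists (idm a), (idm a); rewrite cmp1m. Qed.

Lemma is_equivalence_id : is_equivalence (functor_id C).
Proof.
by exists (functor_id C); split; exists (end_unitl (functor_id C));
  exists (end_unitlV (functor_id C)); split; apply: nat_transP => a /=;
  rewrite cmp1m.
Qed.

Lemma quasi_inverse_comp (F F' G G' : endofunctors C) :
  isomorphic (tens F' F) munit -> isomorphic (tens G' G) munit ->
  isomorphic (tens (tens G' F') (tens F G)) munit.
Proof.
move=> iF iG.
apply: (isomorphic_trans (b := tens G' (tens F' (tens F G)))).
  by exists (massoc _ _ _); apply: massoc_iso.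
apply: isomorphic_trans iG; apply: isomorphic_tens; first exact: isomorphic_refl.
apply: (isomorphic_trans (b := tens (tens F' F) G)).
  by apply: isomorphic_sym; exists (massoc _ _ _); apply: massoc_iso.
apply: (isomorphic_trans (b := tens munit G)).
  by apply: isomorphic_tens => //; apply: isomorphic_refl.
by exists (munitl G); apply: munitl_iso.
Qed.

Lemma is_equivalence_comp (F G : functor C C) :
  is_equivalence F -> is_equivalence G -> is_equivalence (functor_comp F G).
Proof.
move=> [F' [F'F FF']] [G' [G'G GG']]; exists (functor_comp G' F'); split.
  exact: (@quasi_inverse_comp F F' G G').
exact: (@quasi_inverse_comp G' G F' F).
Qed.
End EquivalenceComp.

Definition Aut (C : category) : monoidal_category :=
  @full_monoidal_subcategory (endofunctors C)
    (fun F => @is_equivalence C C F)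
    (@is_equivalence_id C) (@is_equivalence_comp C).

Definition discrete_category (T : Type) : category.
Proof.
refine (@Category T (fun x y => x = y) (fun x => erefl)
  (fun a b c g f => etrans f g) _ _ _).
all: by move=> *; apply: Prop_irrelevance.
Defined.

Lemma discrete_hom_irr (T : Type) (x y : discrete_category T) (f g : hom x y) :
  f = g.
Proof. exact: (@Prop_irrelevance (x = y :> T)). Qed.

Lemma discrete_is_iso (T : Type) (x y : discrete_category T) (f : hom x y) :
  is_iso f.
Proof. by exists (esym f); split; apply: discrete_hom_irr. Qed.

Definition disc (G : zmodType) : monoidal_category.
Proof.
refine (@MonoidalCategory (discrete_category G) (fun x y => (x + y)%R)
  (fun x x' y y' f g => f_equal2 _ f g) 0%R
  (fun x y z => esym (GRing.addrA x y z))
  (fun x => GRing.add0r x) (fun x => GRing.addr0 x) _ _ _ _ _ _ _ _ _ _).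
all: by move=> *; first [exact: discrete_is_iso | exact: discrete_hom_irr].
Defined.

Variant enat := fin of nat | infty.

Definition enat_ge (n : enat) (k : nat) : bool :=
  if n is fin m then k <= m else true.

Definition dim (n : enat) := {k : nat | enat_ge n k}.

Definition dim_nat (n : enat) (i : dim n) : nat := sval i.
Coercion dim_nat : dim >-> nat.

(* A globular set is given by its action on all the arrows of the globe
   category: [src] and [tgt] are the iterated source and target, and likewise
   [idc] is the iterated identity. [ccomp ji v u] is the composite "v after u" of
   i-arrows along their j-dimensional boundary. The axioms say that
   (X_j, X_i) is a category for all j < i, and that (X_j, X_k, X_i) is a
   strict 2-category for all j < k < i. Where an axiom quantifies over several
   composability proofs, those about composites follow from the others.
   Smallness of X is the fact that the universe of its cells is fixed. *)
Record strict_ncat (n : enat) := StrictNCat {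
  cell :> dim n -> Type;
  src : forall j i : dim n, j < i -> cell i -> cell j;
  tgt : forall j i : dim n, j < i -> cell i -> cell j;
  idc : forall j i : dim n, j < i -> cell j -> cell i;
  ccomp : forall (j i : dim n) (ji : j < i) (v u : cell i),
    src ji v = tgt ji u -> cell i;
  src_src : forall (j k i : dim n) (jk : j < k) (ki : k < i) (ji : j < i) u,
    src jk (src ki u) = src ji u;
  src_tgt : forall (j k i : dim n) (jk : j < k) (ki : k < i) (ji : j < i) u,
    src jk (tgt ki u) = src ji u;
  tgt_src : forall (j k i : dim n) (jk : j < k) (ki : k < i) (ji : j < i) u,
    tgt jk (src ki u) = tgt ji u;
  tgt_tgt : forall (j k i : dim n) (jk : j < k) (ki : k < i) (ji : j < i) u,
    tgt jk (tgt ki u) = tgt ji u;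
  src_idc : forall (j i : dim n) (ji : j < i) x, src ji (idc ji x) = x;
  tgt_idc : forall (j i : dim n) (ji : j < i) x, tgt ji (idc ji x) = x;
  idc_idc : forall (j k i : dim n) (jk : j < k) (ki : k < i) (ji : j < i) x,
    idc ki (idc jk x) = idc ji x;
  src_comp : forall (j i : dim n) (ji : j < i) v u (e : src ji v = tgt ji u),
    src ji (ccomp e) = src ji u;
  tgt_comp : forall (j i : dim n) (ji : j < i) v u (e : src ji v = tgt ji u),
    tgt ji (ccomp e) = tgt ji v;
  ccomp_idl : forall (j i : dim n) (ji : j < i) u
      (e : src ji (idc ji (tgt ji u)) = tgt ji u),
    ccomp e = u;
  ccomp_idr : forall (j i : dim n) (ji : j < i) u
      (e : src ji u = tgt ji (idc ji (src ji u))),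
    ccomp e = u;
  ccompA : forall (j i : dim n) (ji : j < i) w v u
      (e_wv : src ji w = tgt ji v) (e_vu : src ji v = tgt ji u)
      (e_w_vu : src ji w = tgt ji (ccomp e_vu))
      (e_wv_u : src ji (ccomp e_wv) = tgt ji u),
    ccomp e_w_vu = ccomp e_wv_u;
  src_comp_lower : forall (j k i : dim n) (jk : j < k) (ki : k < i)
      (ji : j < i) v u (e : src ji v = tgt ji u)
      (e' : src jk (src ki v) = tgt jk (src ki u)),
    src ki (ccomp e) = ccomp e';
  tgt_comp_lower : forall (j k i : dim n) (jk : j < k) (ki : k < i)
      (ji : j < i) v u (e : src ji v = tgt ji u)
      (e' : src jk (tgt ki v) = tgt jk (tgt ki u)),
    tgt ki (ccomp e) = ccomp e';
  idc_comp : forall (j k i : dim n) (jk : j < k) (ki : k < i)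
      (ji : j < i) y x (e : src jk y = tgt jk x)
      (e' : src ji (idc ki y) = tgt ji (idc ki x)),
    idc ki (ccomp e) = ccomp e';
  exchange : forall (j k i : dim n) (ki : k < i) (ji : j < i) v' v u' u,
    j < k ->
    forall (e_v : src ki v' = tgt ki v) (e_u : src ki u' = tgt ki u)
      (e_vu : src ji (ccomp e_v) = tgt ji (ccomp e_u))
      (e' : src ji v' = tgt ji u') (e : src ji v = tgt ji u)
      (e_k : src ki (ccomp e') = tgt ki (ccomp e)),
    ccomp e_vu = ccomp e_k
}.
Arguments src {_} _ {_ _}.
Arguments tgt {_} _ {_ _}.
Arguments idc {_} _ {_ _}.
Arguments ccomp {_} _ {_ _} _ _ _.

Record strict_nfunctor (n : enat) (X Y : strict_ncat n) := StrictNFunctor {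
  nfun :> forall i : dim n, X i -> Y i;
  nfun_src : forall (j i : dim n) (ji : j < i) u,
    nfun (src X ji u) = src Y ji (nfun u);
  nfun_tgt : forall (j i : dim n) (ji : j < i) u,
    nfun (tgt X ji u) = tgt Y ji (nfun u);
  nfun_idc : forall (j i : dim n) (ji : j < i) x,
    nfun (idc X ji x) = idc Y ji (nfun x);
  nfun_comp : forall (j i : dim n) (ji : j < i) v u
      (e : src X ji v = tgt X ji u)
      (e' : src Y ji (nfun v) = tgt Y ji (nfun u)),
    nfun (ccomp X ji v u e) = ccomp Y ji (nfun v) (nfun u) e'
}.
Arguments nfun {_ _ _} _ {_}.

Section NCat.
Variable n : enat.
Implicit Types X Y Z : strict_ncat n.

Lemma strict_nfunctorP X Y (F G : strict_nfunctor X Y) :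
  (forall i (u : X i), F i u = G i u) -> F = G.
Proof.
case: F G => F ? ? ? ? [G ? ? ? ?] /= FG.
have {}FG : F = G.
  by do 2! [apply: functional_extensionality_dep => ?]; apply: FG.
by subst G; congr StrictNFunctor; apply: Prop_irrelevance.
Qed.

Definition nfunctor_id X : strict_nfunctor X X.
Proof.
refine (@StrictNFunctor n X X (fun i u => u) _ _ _ _) => //.
by move=> *; congr ccomp; apply: Prop_irrelevance.
Defined.

Definition nfunctor_comp X Y Z (G : strict_nfunctor Y Z)
  (F : strict_nfunctor X Y) : strict_nfunctor X Z.
Proof.
refine (@StrictNFunctor n X Z (fun i u => nfun G (nfun F u)) _ _ _ _).
- by move=> *; rewrite !nfun_src.
- by move=> *; rewrite !nfun_tgt.
- by move=> *; rewrite !nfun_idc.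
- move=> j i ji v u e e'.
  have e1 : src Y ji (nfun F v) = tgt Y ji (nfun F u).
    by rewrite -nfun_src -nfun_tgt e.
  by rewrite (nfun_comp e e1) (nfun_comp e1 e').
Defined.

Definition nCat : category.
Proof.
refine (@Category (strict_ncat n) (@strict_nfunctor n)
  nfunctor_id nfunctor_comp _ _ _).
all: by move=> *; apply: strict_nfunctorP.
Defined.

Definition strictly_invertible X (j i : dim n) (ji : j < i) (u : X i) : Prop :=
  exists (v : X i) (e : src X ji v = tgt X ji u)
         (e' : src X ji u = tgt X ji v),
    ccomp X ji v u e = idc X ji (src X ji u) /\
    ccomp X ji u v e' = idc X ji (tgt X ji u).

Definition rigid X : Prop :=
  forall (j i : dim n) (ji : j < i), i = j.+1 :> nat ->
  forall u : X i, strictly_invertible ji u -> exists x : X j, u = idc X ji x.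

Definition nCat_r : category := @full_subcategory nCat rigid.

End NCat.

Definition Z2pow (n : enat) : zmodType :=
  {k : nat | (0 < k) && enat_ge n k} -> 'Z_2.

(* Main.v *)
From mathcomp Require Import all_boot all_algebra zify.
From mathcomp Require Import boolp.
Require Import Defs.

(** An autoequivalence of the category of strict n-categories can only reverse
    the direction of the cells in some of the dimensions 1, ..., n. For
    [w : nat -> bool], let [dual w X] be X with source and target along
    dimension j exchanged for every j such that [w j]; this reverses the cells
    of dimension j + 1. Two facts give the theorem: every autoequivalence F is
    isomorphic to some [dual w] ([autoequivalence_dual]), and a natural
    transformation from [dual w] to [dual w'] is the identity on cells and
    forces w and w' to agree on all j < n ([dual_hom_id]). As the duals compose
    by adding their bits, the autoequivalences form a monoidal category with at
    most one morphism between two objects and with (Z/2)^n as group of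
    isomorphism classes; such a monoidal category is equivalent to a discrete
    one ([aut_discrete]).

    The test objects are the globes D_k: a k-cell of X is a functor from D_k to
    X ([cellmap], [cellmap_eq]). A natural transformation between duals is thus
    determined by the images of the principal cells, and by induction on k the
    image of the principal k-cell has the boundary of that cell, up to the
    reversals; a nondegenerate cell of D_k is determined by its boundary.

    Let now F be an autoequivalence with quasi-inverse G.
    - F fixes the globes. Two functors out of D_k that differ only on the
      principal cell stay distinct under F, hence are distinguished by a cell
      of F(D_k), that is, by a morphism from some G(D_i) to D_k, which must hit
      the principal cell: D_k is a retract of G(D_i)
      ([globe_retract_of_image]). By symmetry G(D_i) is a retract of a globe,
      and retracts of globes are globes ([retract_of_globe]); so G permutes the
      globes up to isomorphism, preserving the retract order, and this forces
      G(D_i) to be isomorphic to D_i ([globe_fixed]).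
    - Consequently there are natural bijections theta from the k-cells of X to
      those of F(X) ([natural_cells]). The transported source and target are
      natural operations on cells, hence again the source and the target or
      the other way round ([boundary_twist]). Composing F with a dual reduces
      to the case in which theta preserves sources and targets.
    - Then theta preserves identities by a computation in D_j, and composition
      as follows. In a globe every composite involves an identity, so theta
      preserves it. A composable pair u, v in an arbitrary X lifts to an
      n-category over D_k * D_k * X in which the composite is the only cell
      above a pair of principal cells ([glue_cover]); the first case determines
      the projections of the transported composite to the two globes, hence
      that composite itself ([theta_comp]).

    All the constructions stay within rigid n-categories, so the argument is
    carried out in the full subcategory on any class of n-categories closed
    under them ([admissible]). *)

Set Implicit Arguments.
Unset Strict Implicit.
Unset Printing Implicit Defensive.

Local Open Scope cat_scope.

(** * Retracts, equivalences and restriction of functors *)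

Section Retracts.
Variable C : category.
Implicit Types a b c : C.

Definition retract a b := exists (s : hom a b) (r : hom b a), r \o s = idm a.

Lemma isomorphic_retract a b : isomorphic a b -> retract a b.
Proof. by case=> f [g [gf _]]; exists f, g. Qed.

Lemma retract_trans a b c : retract a b -> retract b c -> retract a c.
Proof.
move=> [s [r rs]] [s' [r' rs']]; exists (s' \o s), (r \o r').
by rewrite cmpA -(cmpA r) rs' cmpm1.
Qed.
End Retracts.

Lemma retract_fmap (C D : category) (F : functor C D) a b :
  retract a b -> retract (F a) (F b).
Proof.
by case=> s [r rs]; exists (fmap F s), (fmap F r); rewrite -fmapM rs fmap1.
Qed.

Lemma isomorphic_fmap (C D : category) (F : functor C D) a b :
  isomorphic a b -> isomorphic (F a) (F b).
Proof.
case=> f [g [gf fg]]; exists (fmap F f), (fmap F g).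
by rewrite -!fmapM gf fg !fmap1.
Qed.

Notation nat_isomorphic := (@isomorphic (functor_category _ _)).

Section NatIso.
Variables C D : category.
Implicit Types F G : functor C D.

Lemma nat_iso_component F G a :
  nat_isomorphic F G -> isomorphic (F a) (G a).
Proof.
case=> t [s [st ts]]; exists (t a), (s a); split.
  exact: (congr1 (fun u : nat_trans F F => u a) st).
exact: (congr1 (fun u : nat_trans G G => u a) ts).
Qed.

Lemma pointwise_nat_iso F G (t : nat_trans F G) :
  (forall a, is_iso (t a)) -> nat_isomorphic F G.
Proof.
move=> iso_t; pose s a := sval (cid (iso_t a)).
have sP a : s a \o t a = idm (F a) /\ t a \o s a = idm (G a).
  by rewrite /s; case: cid.
unshelve eexists t, (@NatTrans C D G F s _).
  move=> a b f; rewrite -[LHS]cmp1m -(sP b).1 -!cmpA; congr (_ \o _).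
  by rewrite (cmpA (t b)) -ncomp_nat -cmpA (sP a).2 cmpm1.
by split; apply: nat_transP => a; case: (sP a).
Qed.
End NatIso.

Section QuasiInverse.
Variables (C D : category) (F : functor C D) (G : functor D C).
Hypothesis GF : nat_isomorphic (functor_comp G F) (functor_id C).

Lemma left_inverse_faithful a b (f g : hom a b) : fmap F f = fmap F g -> f = g.
Proof.
case: GF => t [s [st ts]] fg.
have tsa : t a \o s a = idm a :=
  congr1 (fun u : nat_trans (functor_id C) (functor_id C) => u a) ts.
rewrite -[f]cmpm1 -[g]cmpm1 -tsa !cmpA.
by rewrite (ncomp_nat t f : f \o t a = _) (ncomp_nat t g : g \o t a = _) /= fg.
Qed.
End QuasiInverse.

Section Equivalence.
Variables (C D : category) (F : functor C D) (G : functor D C).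
Hypothesis GF : nat_isomorphic (functor_comp G F) (functor_id C).
Hypothesis FG : nat_isomorphic (functor_comp F G) (functor_id D).

(** The preimage of h is the conjugate of G(h) by the isomorphism from GF to
    the identity; that it is mapped to h follows from faithfulness of G. *)
Lemma equivalence_full a b (h : hom (F a) (F b)) : exists f, fmap F f = h.
Proof.
case: (GF) => t [s [st ts]].
have tsa c : t c \o s c = idm c :=
  congr1 (fun u : nat_trans (functor_id C) (functor_id C) => u c) ts.
have sta c : s c \o t c = idm (G (F c)) :=
  congr1 (fun u : nat_trans (functor_comp G F) (functor_comp G F) => u c) st.
exists (t b \o (fmap G h \o s a)); apply: (left_inverse_faithful FG).
set f := t b \o _.
have : f \o t a = t b \o fmap G (fmap F f) := ncomp_nat t f.
rewrite {1}/f -!cmpA sta cmpm1 => /(congr1 (fun u => s b \o u)).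
by rewrite !cmpA sta !cmp1m => ->.
Qed.
End Equivalence.

Section QuasiInverses.
Variable C : category.
Implicit Types F G : functor C C.

Definition quasi_inverse F G :=
  nat_isomorphic (functor_comp G F) (functor_id C) /\
  nat_isomorphic (functor_comp F G) (functor_id C).

Lemma quasi_inverse_sym F G : quasi_inverse F G -> quasi_inverse G F.
Proof. by case. Qed.

Lemma quasi_inverse_iso F G :
  quasi_inverse F G -> forall a, isomorphic (G (F a)) a.
Proof. by case=> GF _ a; apply: (nat_iso_component a GF). Qed.
End QuasiInverses.

Section Restriction.
Variables (C : category) (P : C -> Prop).
Let CP := full_subcategory P.

Definition restrict (F : functor C C) (PF : forall a, P a -> P (F a)) :
  functor CP CP :=
  @Functor CP CP (fun a => exist P (F (sval a)) (PF _ (svalP a)))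
    (fun a b f => fmap F f) (fun a => fmap1 F (sval a))
    (fun a b c g f => fmapM F g f).

Lemma restrict_iso (F G : functor C C) (PF : forall a, P a -> P (F a))
    (PG : forall a, P a -> P (G a)) :
  nat_isomorphic F G ->
  nat_isomorphic (restrict PF) (restrict PG).
Proof.
case=> t [s [st ts]].
exists (@NatTrans CP CP (restrict PF) (restrict PG) (fun a => t (sval a))
  (fun a b f => ncomp_nat t f)).
exists (@NatTrans CP CP (restrict PG) (restrict PF) (fun a => s (sval a))
  (fun a b f => ncomp_nat s f)).
split; apply: nat_transP => a.
  exact: (congr1 (fun u : nat_trans F F => u (sval a)) st).
exact: (congr1 (fun u : nat_trans G G => u (sval a)) ts).
Qed.

Lemma restrict_comp (F G : functor C C) (PF : forall a, P a -> P (F a))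
    (PG : forall a, P a -> P (G a))
    (PFG : forall a, P a -> P (functor_comp F G a)) :
  nat_isomorphic
    (functor_comp (restrict PF) (restrict PG)) (restrict PFG).
Proof.
pose FG := functor_comp F G.
unshelve eapply pointwise_nat_iso.
  exists (fun a => idm (FG (sval a))) => a b f; exact: nat_id_nat.
by move=> a; exists (idm (FG (sval a))); split; apply: cmp1m.
Qed.

Lemma restrict_id (Pid : forall a, P a -> P (functor_id C a)) :
  nat_isomorphic (functor_id CP) (restrict Pid).
Proof.
unshelve eapply pointwise_nat_iso.
  exists (fun a => idm (sval a)) => a b f; exact: (nat_id_nat (functor_id C)).
by move=> a; exists (idm (sval a)); split; apply: cmp1m.
Qed.

Lemma unrestrict_iso (F G : functor C C) (PF : forall a, P a -> P (F a))
    (PG : forall a, P a -> P (G a)) :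
  (forall a, P a) ->
  nat_isomorphic (restrict PF) (restrict PG) ->
  nat_isomorphic F G.
Proof.
move=> Pall [t [s [st ts]]]; pose o a : CP := exist P a (Pall a).
exists (@NatTrans C C F G (fun a => t (o a))
  (fun a b f => @ncomp_nat _ _ _ _ t (o a) (o b) f)).
exists (@NatTrans C C G F (fun a => s (o a))
  (fun a b f => @ncomp_nat _ _ _ _ s (o a) (o b) f)).
split; apply: nat_transP => a.
  exact: (congr1 (fun u : nat_trans (restrict PF) (restrict PF) => u (o a)) st).
exact: (congr1 (fun u : nat_trans (restrict PG) (restrict PG) => u (o a)) ts).
Qed.
End Restriction.

(** * Boundaries and identities of cells *)

Section Cells.
Variable n : enat.
Implicit Types (X Y : strict_ncat n) (i j k l m : dim n).

Variant dim_compare i j : Prop :=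
  | DimLt of i < j | DimEq of i = j | DimGt of j < i.

Lemma dimP i j : dim_compare i j.
Proof.
case: (ltngtP (i : nat) j) => h; [exact: DimLt|exact: DimGt|apply: DimEq].
exact: val_inj.
Qed.

Lemma dim_eq i j : ~ i < j -> ~ j < i -> i = j.
Proof. by case: (dimP i j). Qed.

Lemma dim_le_proof k (p : nat) : p <= k -> enat_ge n p.
Proof. by case: k => k /=; case: (n) => //= q kq pk; apply: leq_trans kq. Qed.

Definition dim_le k (p : nat) (h : p <= k) : dim n :=
  exist _ p (dim_le_proof h).

Lemma ccomp_eq X j i (ji ji' : j < i) v v' u u' e e' :
  v = v' -> u = u' -> ccomp X ji v u e = ccomp X ji' v' u' e'.
Proof.
move=> vv uu; subst v' u'; have ji_eq : ji = ji' by apply: Prop_irrelevance.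
by subst ji'; congr ccomp; apply: Prop_irrelevance.
Qed.

Lemma ccomp_unitl X j i (ji : j < i) v u e x :
  v = idc X ji x -> ccomp X ji v u e = u.
Proof.
move=> vx; subst v; have xE : x = tgt X ji u by rewrite -e src_idc.
by subst x; apply: ccomp_idl.
Qed.

Lemma ccomp_unitr X j i (ji : j < i) v u e x :
  u = idc X ji x -> ccomp X ji v u e = v.
Proof.
move=> ux; subst u; have xE : x = src X ji v by rewrite e tgt_idc.
by subst x; apply: ccomp_idr.
Qed.

(** Treating source and target as two values of one parameter lets each
    argument about boundaries be given once, and makes reversal an exclusive
    or of parameters. *)
Definition bnd (b : bool) X j i (ji : j < i) : X i -> X j :=
  if b then tgt X ji else src X ji.

Lemma bnd_bnd b b' X j k i (jk : j < k) (ki : k < i) (ji : j < i) (u : X i) :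
  bnd b jk (bnd b' ki u) = bnd b ji u.
Proof.
by case: b b' => -[]; rewrite /bnd ?tgt_tgt ?tgt_src ?src_tgt ?src_src.
Qed.

Lemma bnd_idc b X j i (ji : j < i) (x : X j) : bnd b ji (idc X ji x) = x.
Proof. by case: b; rewrite /bnd ?tgt_idc ?src_idc. Qed.

Lemma nfun_bnd X Y (F : strict_nfunctor X Y) b j i (ji : j < i) (u : X i) :
  F _ (bnd b ji u) = bnd b ji (F _ u).
Proof. by case: b; rewrite /bnd ?nfun_tgt ?nfun_src. Qed.

Definition lt_dec i j : decidable (i < j) := decP idP.

(** A total operation between the cells of any two dimensions: iterated
    identity upwards, iterated source or target downwards. It lets the
    image in X of a cell of a globe be written by one formula, whatever the
    dimensions. *)
Definition shift (b : bool) X i j (x : X i) : X j :=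
  match lt_dec i j, lt_dec j i with
  | left ij, _ => idc X ij x
  | _, left ji => bnd b ji x
  | right ij, right ji => ecast p (X p) (dim_eq ij ji) x
  end.

Lemma shift_lt b X i j (ij : i < j) (x : X i) : shift b j x = idc X ij x.
Proof.
rewrite /shift; case: (lt_dec i j) => [ij'|//].
by congr idc; apply: Prop_irrelevance.
Qed.

Lemma shift_gt b X i j (ji : j < i) (x : X i) : shift b j x = bnd b ji x.
Proof.
rewrite /shift; case: (lt_dec i j) => [ij|nij]; first lia.
case: (lt_dec j i) => [ji'|//].
by congr bnd; apply: Prop_irrelevance.
Qed.

Lemma shift_refl b X i (x : X i) : shift b i x = x.
Proof.
rewrite /shift; case: {1}(lt_dec i i) => [|n1]; first lia.
case: (lt_dec i i) => [|n2]; first lia.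
by rewrite (_ : dim_eq n1 n2 = erefl) //; apply: Prop_irrelevance.
Qed.

Lemma nfun_shift X Y (F : strict_nfunctor X Y) b i j (x : X i) :
  F j (shift b j x) = shift b j (F i x).
Proof.
case: (dimP i j) => [h|h|h]; first by rewrite !shift_lt nfun_idc.
  by subst j; rewrite !shift_refl.
by rewrite !shift_gt nfun_bnd.
Qed.

Lemma bnd_shift_idc b s X l j i (ji : j < i) (y : X l) :
  l <= j -> bnd b ji (shift s i y) = shift s j y.
Proof.
case: (dimP l j) => h lj; last lia.
  have li : l < i by lia.
  by rewrite !shift_lt -(idc_idc h ji li) bnd_idc.
by subst l; rewrite shift_refl shift_lt bnd_idc.
Qed.

Lemma bnd_shift_bnd b s X l j i (ji : j < i) (jl : j < l) (y : X l) :
  l <= i -> bnd b ji (shift s i y) = bnd b jl y.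
Proof.
case: (dimP l i) => h li; last lia.
  by rewrite shift_lt -(bnd_bnd b b jl h ji) bnd_idc.
by subst i; rewrite shift_refl (_ : ji = jl) //; apply: Prop_irrelevance.
Qed.

Lemma idc_shift s X l j i (ji : j < i) (y : X l) :
  l <= j -> idc X ji (shift s j y) = shift s i y.
Proof.
case: (dimP l j) => h lj; last lia.
  have li : l < i by lia.
  by rewrite !shift_lt (idc_idc h ji li).
by subst l; rewrite shift_refl shift_lt.
Qed.

Lemma bnd_bnd_shift b s X l j k (jl : j < l) (jk : j < k) (x : X k) :
  l <= k -> bnd b jl (shift s l x) = bnd b jk x.
Proof.
case: (dimP l k) => h lk; last lia; first by rewrite shift_gt bnd_bnd.
by subst l; rewrite shift_refl; congr bnd; apply: Prop_irrelevance.
Qed.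

Lemma shift_shift s t X l m (x : X l) :
  l <= m -> shift s l (shift t m x) = x.
Proof.
case: (dimP l m) => h lm; last lia.
  by rewrite (shift_lt _ h) (shift_gt _ h) bnd_idc.
by subst l; rewrite !shift_refl.
Qed.

End Cells.

(** * Globes *)

Section Globe.
Variable n : enat.

(** A cell of the k-globe is an iterated identity of a unique nondegenerate
    cell; the latter is encoded by its dimension l and a side, false for the
    source side and true for the target side. There is only one nondegenerate
    cell of dimension k, and it is given the side true. *)
Definition gvalid (k i : nat) (p : nat * bool) :=
  [&& p.1 <= i, p.1 <= k & (p.1 == k) ==> p.2].

Definition gcell (k i : nat) := {p : nat * bool | gvalid k i p}.

Definition GCell k i p (h : gvalid k i p) : gcell k i :=
  @exist _ (fun p => gvalid k i p) p h.

Definition gbnd (b : bool) (j : nat) (p : nat * bool) :=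
  if p.1 <= j then p else (j, b).

(** In a globe one of two composable cells is always an identity, so that the
    composite is the other one. *)
Definition gcomp (j : nat) (v u : nat * bool) := if v.1 <= j then u else v.

Arguments gbnd : simpl never.
Arguments gcomp : simpl never.

Lemma gvalid_bnd b k j i p : j < i -> gvalid k i p -> gvalid k j (gbnd b j p).
Proof.
rewrite /gbnd /gvalid; case: p => l s ji /and3P[/= li lk le].
by case: ifP => h /=; apply/and3P; split=> //; lia.
Qed.

Lemma gvalid_id k j i p : j < i -> gvalid k j p -> gvalid k i p.
Proof. by rewrite /gvalid; lia. Qed.

Lemma gvalid_comp k j i v u :
  gvalid k i v -> gvalid k i u -> gvalid k i (gcomp j v u).
Proof. by rewrite /gcomp; case: ifP. Qed.

Lemma gcomposableP j v u : gbnd false j v = gbnd true j u ->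
  [\/ [/\ v.1 <= j, u.1 <= j & v = u],
      [/\ v.1 <= j, j < u.1 & v = (j, true)] |
      [/\ j < v.1, u.1 <= j & u = (j, false)]].
Proof.
rewrite /gbnd; case: (leqP v.1 j); case: (leqP u.1 j) => ju jv.
- by move=> e; constructor 1.
- by move=> e; constructor 2.
- by move=> e; constructor 3.
- by [].
Qed.

Ltac gcase H :=
  move: H => /gcomposableP [] [/= ? ?] [? ?]; try lia.

Ltac globe_solve :=
  rewrite /gcomp /gbnd /=;
  repeat match goal with
  | |- context [if ?a <= ?b then _ else _] =>
      lazymatch a with context [if _ then _ else _] => fail | _ => idtac end;
      case: (leqP a b) => ? /=; try lia
  end; try done; try (congr pair; lia).

Lemma gbnd_bnd b b' j k p : j < k -> gbnd b j (gbnd b' k p) = gbnd b j p.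
Proof. by case: p => l s jk; globe_solve. Qed.

Lemma gbnd_id b k j p : gvalid k j p -> gbnd b j p = p.
Proof. by case/and3P; rewrite /gbnd => ->. Qed.

Lemma gbnd_src_comp j v u : gbnd false j v = gbnd true j u ->
  gbnd false j (gcomp j v u) = gbnd false j u.
Proof. by move: v u => [lv sv] [lu su] e; gcase e; globe_solve. Qed.

Lemma gbnd_tgt_comp j v u : gbnd false j v = gbnd true j u ->
  gbnd true j (gcomp j v u) = gbnd true j v.
Proof. by move: v u => [lv sv] [lu su] e; gcase e; globe_solve. Qed.

Lemma gcomp_idl j b u : gcomp j (gbnd b j u) u = u.
Proof. by case: u => l s; globe_solve. Qed.

Lemma gcomp_idr j u : gcomp j u (gbnd false j u) = u.
Proof. by case: u => l s; globe_solve. Qed.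

Lemma gcompA j w v u :
  gcomp j w (gcomp j v u) = gcomp j (gcomp j w v) u.
Proof. by move: w v u => [lw sw] [lv sv] [lu su]; globe_solve. Qed.

Lemma gbnd_comp_lower b j k v u : j < k -> gbnd false j v = gbnd true j u ->
  gbnd b k (gcomp j v u) = gcomp j (gbnd b k v) (gbnd b k u).
Proof. by move: v u => [lv sv] [lu su] jk e; gcase e; globe_solve. Qed.

Lemma gexchange j k v' v u' u : j < k ->
  gbnd false k v' = gbnd true k v -> gbnd false k u' = gbnd true k u ->
  gbnd false j v' = gbnd true j u' -> gbnd false j v = gbnd true j u ->
  gcomp j (gcomp k v' v) (gcomp k u' u) = gcomp k (gcomp j v' u') (gcomp j v u).
Proof.
move: v' v u' u => [? ?] [? ?] [? ?] [? ?] jk e1 e2 e3 e4.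
gcase e1; gcase e2; gcase e3; gcase e4; globe_solve.
Qed.

Definition globe (k : nat) : strict_ncat n.
Proof.
refine (@StrictNCat n (fun i => gcell k i)
  (fun j i ji u => @GCell _ _ _ (gvalid_bnd false ji (svalP u)))
  (fun j i ji u => @GCell _ _ _ (gvalid_bnd true ji (svalP u)))
  (fun j i ji u => @GCell _ _ _ (gvalid_id ji (svalP u)))
  (fun j i ji v u _ => @GCell _ _ _ (gvalid_comp j (svalP v) (svalP u)))
  _ _ _ _ _ _ _ _ _ _ _ _ _ _ _ _).
all: intros; apply: val_inj => /=.
all: repeat match goal with H : _ = _ |- _ => move/(congr1 val): H => /= H end.
- exact: gbnd_bnd.
- exact: gbnd_bnd.
- exact: gbnd_bnd.
- exact: gbnd_bnd.
- exact: gbnd_id (svalP x).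
- exact: gbnd_id (svalP x).
- by [].
- exact: gbnd_src_comp.
- exact: gbnd_tgt_comp.
- exact: gcomp_idl.
- exact: gcomp_idr.
- exact: gcompA.
- exact: gbnd_comp_lower.
- exact: gbnd_comp_lower.
- by [].
- exact: gexchange.
Defined.
End Globe.

Section GlobeMaps.
Variable n : enat.
Implicit Types (X Y : strict_ncat n) (i j k l m : dim n).

Lemma gcell_le (m : nat) i (c : gcell m i) : (val c).1 <= m.
Proof. by case/and3P: (valP c). Qed.

Lemma val_bnd b (m : nat) j i (ji : j < i) (c : globe n m i) :
  val (bnd b ji c) = gbnd b j (val c).
Proof. by case: b. Qed.

(** A map out of a globe that respects boundaries and identities is a functor
    because of this. *)
Lemma globe_comp_trivial (m : nat) j i (ji : j < i) (v u : globe n m i) e :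
  (v = idc _ ji (src _ ji v) /\ ccomp _ ji v u e = u) \/
  (u = idc _ ji (src _ ji u) /\ ccomp _ ji v u e = v).
Proof.
case: (leqP (val v).1 j) => vj.
  by left; split; apply: val_inj => /=; rewrite /gbnd /gcomp vj.
right; split; apply: val_inj => /=; last by rewrite /gcomp leqNgt vj.
move/(congr1 val): e => /=.
by rewrite /gbnd leqNgt vj /=; case: ifP => // _ [].
Qed.

Section CellMap.
Variables (k : dim n) (X : strict_ncat n) (x : X k).

Definition cellmap_at (l : dim n) (s : bool) i : X i :=
  shift s i (shift s l x).

Definition cellmap_fun i (c : gcell k i) : X i :=
  cellmap_at (dim_le (gcell_le c)) (val c).2 i.

Lemma cellmap_funE i (c : gcell k i) l s :
  val c = (l : nat, s) -> cellmap_fun c = cellmap_at l s i.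
Proof.
move=> cE; rewrite /cellmap_fun; have -> : (val c).2 = s by rewrite cE.
by rewrite (_ : dim_le _ = l) //; apply: val_inj; rewrite /= cE.
Qed.

Lemma cellmap_bnd b j i (ji : j < i) (c : globe n k i) :
  cellmap_fun (bnd b ji c) = bnd b ji (cellmap_fun c).
Proof.
have lk := gcell_le c; case/and3P: (valP c) => li _ _.
case cE : (val c) lk li => [l s] /= lk li.
rewrite (@cellmap_funE _ c (dim_le lk) s) //.
case: (leqP l j) => lj.
  rewrite (@cellmap_funE _ _ (dim_le lk) s); last first.
    by rewrite val_bnd cE /gbnd /= lj.
  by rewrite /cellmap_at bnd_shift_idc.
rewrite (@cellmap_funE _ _ j b); last by rewrite val_bnd cE /gbnd /= leqNgt lj.
have jk : j < k by lia.
rewrite /cellmap_at shift_refl shift_gt (@bnd_shift_bnd _ _ _ _ (dim_le lk)) //.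
symmetry.
by apply: (@bnd_bnd_shift _ _ _ _ (dim_le lk)) => //=; lia.
Qed.

Lemma cellmap_idc j i (ji : j < i) (c : globe n k j) :
  cellmap_fun (idc (globe n k) ji c) = idc X ji (cellmap_fun c).
Proof.
have lk := gcell_le c; case/and3P: (valP c) => lj _ _.
case cE : (val c) lk lj => [l s] /= lk lj.
rewrite (@cellmap_funE _ c (dim_le lk) s) //.
by rewrite (@cellmap_funE _ _ (dim_le lk) s) // /cellmap_at idc_shift.
Qed.

Definition cellmap : strict_nfunctor (globe n k) X.
Proof.
refine (@StrictNFunctor n (globe n k) X cellmap_fun _ _ _ _).
- by move=> j i ji u; apply: (cellmap_bnd false).
- by move=> j i ji u; apply: (cellmap_bnd true).
- exact: cellmap_idc.
- move=> j i ji v u e e'.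
  case: (globe_comp_trivial e) => -[h ->].
    by rewrite (@ccomp_unitl _ _ _ _ _ _ _ _ (cellmap_fun (src _ ji v))) //
      -cellmap_idc -h.
  by rewrite (@ccomp_unitr _ _ _ _ _ _ _ _ (cellmap_fun (src _ ji u))) //
    -cellmap_idc -h.
Defined.
End CellMap.

Lemma gvalid_prin k : gvalid k k (k : nat, true).
Proof. by rewrite /gvalid /= leqnn implybT. Qed.

Definition prin k : globe n k k := GCell (gvalid_prin k).

Lemma cellmap_prin k X (x : X k) : cellmap x k (prin k) = x.
Proof.
by rewrite /= (@cellmap_funE _ _ _ _ _ k true) // /cellmap_at !shift_refl.
Qed.

Lemma globe_cellE k i (c : globe n k i) : cellmap (prin k) i c = c.
Proof.
have lk := gcell_le c; case/and3P: (valP c) => li _ ls.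
case cE : (val c) lk li ls => [l s] /= lk li ls.
rewrite (@cellmap_funE _ _ _ _ _ (dim_le lk) s) // /cellmap_at.
apply: val_inj; rewrite cE.
have -> : val (shift s i (shift s (dim_le lk) (prin k) : globe n k _)) =
   val (shift s (dim_le lk) (prin k) : globe n k _).
  case: (dimP (dim_le lk) i) => h; first by rewrite shift_lt.
    by move: h => <-; rewrite shift_refl.
  by move: h => /=; lia.
case: (dimP k (dim_le lk)) => h; first by move: h => /=; lia.
  have kl : k = l :> nat by rewrite h.
  have -> : s by move: ls; rewrite kl eqxx.
  by rewrite -h shift_refl /= kl.
by rewrite shift_gt // val_bnd /= /gbnd /=; case: leqP h => //=; lia.
Qed.

Lemma cellmap_nfun k X (F : strict_nfunctor (globe n k) X) i (c : globe n k i) :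
  F i c = cellmap (F k (prin k)) i c.
Proof.
by rewrite -{1}(globe_cellE c) /= /cellmap_fun /cellmap_at !nfun_shift.
Qed.

Lemma cellmap_eq k X (F G : strict_nfunctor (globe n k) X) :
  F k (prin k) = G k (prin k) -> F = G.
Proof.
move=> FG; apply: strict_nfunctorP => i c.
by rewrite (cellmap_nfun F) (cellmap_nfun G) FG.
Qed.
End GlobeMaps.

(** * The flag object *)

Section Flag.
Variable n : enat.
Implicit Types (i j : dim n) (k : nat).

(** The top cell exists from dimension k on. Taking the disjunction as
    composition in every direction is consistent because two composable cells
    are equal as soon as the direction is at least k. *)
Definition fvalid (k i : nat) (b : bool) := b ==> (k <= i).
Definition fcell (k i : nat) := {b : bool | fvalid k i b}.
Definition FCell k i b (h : fvalid k i b) : fcell k i :=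
  @exist _ (fun b => fvalid k i b) b h.

Lemma fvalid_bnd k j (b : bool) : fvalid k j (b && (k <= j)).
Proof. by rewrite /fvalid; case: b => //=; apply: implybb. Qed.

Lemma fvalid_id k j i b : j < i -> fvalid k j b -> fvalid k i b.
Proof. by rewrite /fvalid; case: b => //=; lia. Qed.

Lemma fvalid_comp k i v u : fvalid k i v -> fvalid k i u -> fvalid k i (v || u).
Proof. by rewrite /fvalid; case: v u => -[]. Qed.

(** Its purpose is to receive two functors from the k-globe that differ on the
    principal cell only. *)
Definition flag (k : nat) : strict_ncat n.
Proof.
refine (@StrictNCat n (fun i => fcell k i)
  (fun j i ji u => FCell (fvalid_bnd k j (val u)))
  (fun j i ji u => FCell (fvalid_bnd k j (val u)))
  (fun j i ji u => FCell (fvalid_id ji (svalP u)))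
  (fun j i ji v u _ => FCell (fvalid_comp (svalP v) (svalP u)))
  _ _ _ _ _ _ _ _ _ _ _ _ _ _ _ _).
all: intros; apply: val_inj => /=.
all: repeat match goal with H : _ = _ |- _ => move/(congr1 val): H => /= end.
all: repeat match goal with H : fcell _ _ |- _ => case: H => -[] /= H end.
all: rewrite ?H //=; try lia.
all: by rewrite ?H.
Defined.

Lemma flag_rigid k : rigid (flag k).
Proof.
move=> j i ji ij u [v [e [e' [/(congr1 val) /= vu _]]]].
exists (src (flag k) ji u); apply: val_inj => /=.
by move: vu; case: (val u); rewrite /= ?orbT => // <-.
Qed.

Definition flag_bot k : strict_nfunctor (globe n k) (flag k).
Proof.
refine (@StrictNFunctor n (globe n k) (flag k)
  (fun i c => @FCell k i false isT) _ _ _ _).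
all: by intros; apply: val_inj.
Defined.

Lemma fvalid_top k i (c : gcell k i) : fvalid k i ((val c).1 == k).
Proof. by case: c => -[l s] /and3P [/=]; rewrite /fvalid; lia. Qed.

Definition flag_top k : strict_nfunctor (globe n k) (flag k).
Proof.
refine (@StrictNFunctor n (globe n k) (flag k)
  (fun i c => FCell (fvalid_top c)) _ _ _ _).
all: intros; apply: val_inj => /=.
1,2: case: u => -[l s] /= /and3P [/= li lk _].
1,2: by rewrite /gbnd /=; case: leqP => /=; lia.
  by [].
move/(congr1 val): e => /= /gcomposableP; rewrite /gcomp {e'}.
case: v u => -[lv sv] /and3P [/= _ vk _] [[lu su] /and3P [/= _ uk _]] /=.
by case=> -[vj uj [? ?]]; case: leqP => /=; lia.
Defined.
End Flag.

(** * Subobjects of products *)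

Section SubProduct.
Variables (n : enat) (X Y : strict_ncat n).
Implicit Types (i j k : dim n).
Variable P : forall i, X i -> Y i -> Prop.

Record subprod_closed : Prop := SubprodClosed {
  subprod_bnd : forall b j i (ji : j < i) x y,
    P x y -> P (bnd b ji x) (bnd b ji y);
  subprod_idc : forall j i (ji : j < i) x y,
    P x y -> P (idc X ji x) (idc Y ji y);
  subprod_comp : forall j i (ji : j < i) x' y' x y e e',
    P x' y' -> P x y -> P (ccomp X ji x' x e) (ccomp Y ji y' y e')
}.

Hypothesis closedP : subprod_closed.

Record subprod_cell i := SubprodCell {
  spl : X i; spr : Y i; spP : P spl spr
}.

Lemma subprod_cellP i (u v : subprod_cell i) :
  spl u = spl v -> spr u = spr v -> u = v.
Proof.
case: u v => [x y p] [x' y' p'] /= xx yy; subst x' y'.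
by congr SubprodCell; apply: Prop_irrelevance.
Qed.

Definition subprod : strict_ncat n.
Proof.
refine (@StrictNCat n subprod_cell
  (fun j i ji u => SubprodCell (subprod_bnd closedP false ji (spP u)))
  (fun j i ji u => SubprodCell (subprod_bnd closedP true ji (spP u)))
  (fun j i ji u => SubprodCell (subprod_idc closedP ji (spP u)))
  (fun j i ji v u e => SubprodCell (subprod_comp closedP
     (congr1 (@spl j) e : src X ji (spl v) = tgt X ji (spl u))
     (congr1 (@spr j) e : src Y ji (spr v) = tgt Y ji (spr u))
     (spP v) (spP u)))
  _ _ _ _ _ _ _ _ _ _ _ _ _ _ _ _).
all: intros; apply: subprod_cellP => /=; rewrite /bnd.
all: rewrite ?src_src ?src_tgt ?tgt_src ?tgt_tgt ?src_idc ?tgt_idc //.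
all: rewrite ?src_comp ?tgt_comp //.
all: try by [apply: idc_idc | apply: ccomp_unitl | apply: ccomp_unitr
            | apply: ccompA | apply: src_comp_lower | apply: tgt_comp_lower
            | apply: idc_comp | apply: exchange].
Defined.

Definition subprod_fst : strict_nfunctor subprod X.
Proof.
refine (@StrictNFunctor n subprod X (fun i u => spl u) _ _ _ _) => //.
by move=> *; apply: ccomp_eq.
Defined.

Definition subprod_snd : strict_nfunctor subprod Y.
Proof.
refine (@StrictNFunctor n subprod Y (fun i u => spr u) _ _ _ _) => //.
by move=> *; apply: ccomp_eq.
Defined.

Lemma subprod_rigid : rigid X -> rigid Y -> rigid subprod.
Proof.
move=> rX rY j i ji ij u [v [e [e' [vu uv]]]].
have [x xE] : exists x, spl u = idc X ji x.
  apply: rX ij _ _; exists (spl v).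
  exists (congr1 (@spl j) e), (congr1 (@spl j) e').
  by split; [move: (congr1 (@spl i) vu)|move: (congr1 (@spl i) uv)].
have [y yE] : exists y, spr u = idc Y ji y.
  apply: rY ij _ _; exists (spr v).
  exists (congr1 (@spr j) e), (congr1 (@spr j) e').
  by split; [move: (congr1 (@spr i) vu)|move: (congr1 (@spr i) uv)].
exists (src subprod ji u); apply: subprod_cellP => /=; rewrite /bnd.
  by rewrite xE src_idc.
by rewrite yE src_idc.
Qed.
End SubProduct.

(** If v o u is an identity in a globe and one of v, u is an identity, then
    so is u. *)
Lemma globe_rigid n k : rigid (globe n k).
Proof.
move=> j i ji ij u [v [e [e' [vu uv]]]].
case: (globe_comp_trivial e) => -[vE]; last by exists (src _ ji u).
by rewrite vu => <-; exists (src _ ji u).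
Qed.

(** * Duals *)

Section Dual.
Variable n : enat.
Implicit Types (X Y : strict_ncat n) (i j k : dim n) (b : bool).

Definition bcomp b X j i (ji : j < i) (v u : X i) :
    bnd b ji v = bnd (~~ b) ji u -> X i :=
  match b return bnd b ji v = bnd (~~ b) ji u -> X i with
  | true => fun e => ccomp X ji u v (esym e)
  | false => fun e => ccomp X ji v u e
  end.
Arguments bcomp b X {j i} ji v u e.

Lemma bcomp_eq b X j i (ji ji' : j < i) v v' u u' e e' :
  v = v' -> u = u' -> bcomp b X ji v u e = bcomp b X ji' v' u' e'.
Proof. by case: b e e' => /= e e' *; apply: ccomp_eq. Qed.

Lemma nfun_bcomp b X Y (F : strict_nfunctor X Y) j i (ji : j < i) v u e e' :
  F i (bcomp b X ji v u e) = bcomp b Y ji (F i v) (F i u) e'.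
Proof. by case: b e e' => /= e e'; apply: nfun_comp. Qed.

Definition dual (w : nat -> bool) X : strict_ncat n.
Proof.
refine (@StrictNCat n X (fun j i ji => bnd (w j) ji)
  (fun j i ji => bnd (~~ w j) ji) (@idc n X)
  (fun j i ji v u e => bcomp (w j) X ji v u e)
  _ _ _ _ _ _ _ _ _ _ _ _ _ _ _ _).
all: try by intros; apply: bnd_bnd.
all: try by intros; apply: bnd_idc.
- by move=> *; apply: idc_idc.
- move=> j i ji; case: (w j) => v u e /=; first exact: tgt_comp.
  exact: src_comp.
- move=> j i ji; case: (w j) => v u e /=; first exact: src_comp.
  exact: tgt_comp.
- move=> j i ji; case: (w j) => u e /=; first exact: ccomp_unitr.
  exact: ccomp_unitl.
- move=> j i ji; case: (w j) => u e /=; first exact: ccomp_unitl.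
  exact: ccomp_unitr.
- move=> j i ji; case: (w j) => x v u e1 e2 e3 e4 /=; last exact: ccompA.
  by symmetry; apply: ccompA.
- move=> j k i jk ki ji; case: (w j); case: (w k) => v u e e' /=.
  + exact: tgt_comp_lower.
  + exact: src_comp_lower.
  + exact: tgt_comp_lower.
  + exact: src_comp_lower.
- move=> j k i jk ki ji; case: (w j); case: (w k) => v u e e' /=.
  + exact: src_comp_lower.
  + exact: tgt_comp_lower.
  + exact: src_comp_lower.
  + exact: tgt_comp_lower.
- by move=> j k i jk ki ji; case: (w j) => y x e e' /=; apply: idc_comp.
- move=> j k i ki ji v' v u' u jk; case: (w j); case: (w k) => * /=.
  all: exact: exchange.
Defined.

Definition dual_fun w X Y (F : strict_nfunctor X Y) :
  strict_nfunctor (dual w X) (dual w Y).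
Proof.
refine (@StrictNFunctor n (dual w X) (dual w Y) (fun i => F i) _ _ _ _).
- by move=> j i ji u; apply: (nfun_bnd F (w j)).
- by move=> j i ji u; apply: (nfun_bnd F (~~ w j)).
- by move=> j i ji x; apply: (nfun_idc F).
- by move=> j i ji v u e e'; apply: (@nfun_bcomp (w j) X Y F).
Defined.

Lemma bnd_dual w b X j i (ji : j < i) (u : X i) :
  bnd b ji (u : dual w X i) = bnd (b (+) w j) ji u.
Proof. by case: b. Qed.

Lemma bcomp_neg b X j i (ji : j < i) (v u : X i) e e' :
  bcomp (~~ b) X ji v u e = bcomp b X ji u v e'.
Proof. by case: b e e' => /= e e'; apply: ccomp_eq. Qed.

Definition dual_dual w w' X :
  strict_nfunctor (dual w (dual w' X)) (dual (fun m : nat => w m (+) w' m) X).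
Proof.
refine (@StrictNFunctor n (dual w (dual w' X))
  (dual (fun m : nat => w m (+) w' m) X) (fun i u => u) _ _ _ _).
- by move=> j i ji u; apply: (@bnd_dual w' (w j) X).
- by move=> j i ji u /=; rewrite (@bnd_dual w' (~~ w j) X) addNb.
- by [].
- move=> j i ji v u /=; case: (w j) => /= e e'; last exact: bcomp_eq.
  by symmetry; apply: bcomp_neg.
Defined.

Definition dual_id X : strict_nfunctor X (dual (fun=> false) X).
Proof.
refine (@StrictNFunctor n X (dual (fun=> false) X) (fun i u => u)
  _ _ _ _) => //.
by move=> *; apply: ccomp_eq.
Defined.

Lemma bijective_is_iso X Y (F : strict_nfunctor X Y) :
  (forall i, injective (F i)) -> (forall i y, exists x, F i x = y) ->
  @is_iso (nCat n) X Y F.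
Proof.
move=> injF surF; pose g i y := sval (cid (surF i y)).
have gK i y : F i (g i y) = y by rewrite /g; case: cid.
unshelve eexists (@StrictNFunctor n Y X g _ _ _ _).
- by move=> j i ji u; apply: injF; rewrite nfun_src !gK.
- by move=> j i ji u; apply: injF; rewrite nfun_tgt !gK.
- by move=> j i ji u; apply: injF; rewrite nfun_idc !gK.
- move=> j i ji v u e e'; apply: injF; rewrite gK.
  have e2 : src Y ji (F i (g i v)) = tgt Y ji (F i (g i u)) by rewrite !gK.
  by rewrite (nfun_comp e' e2); apply: ccomp_eq; rewrite gK.
- split; apply: strict_nfunctorP => i u /=; last exact: gK.
  by apply: injF; rewrite gK.
Qed.

Lemma dual_rigid w X : rigid X -> rigid (dual w X).
Proof.
move=> rX j i ji ij u [v [e [e' [vu uv]]]].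
move: e e' vu uv => /=; case: (w j) => /= e e' vu uv.
  by apply: rX ij _ _; exists v, (esym e'), (esym e); split.
by apply: rX ij _ _; exists v, e, e'; split.
Qed.
End Dual.

(** * Covering a composable pair *)

Section CompBoundary.
Variables (n : enat) (X : strict_ncat n).
Implicit Types (i j k : dim n).

Lemma bnd_comp_lower b j k i (jk : j < k) (ki : k < i) (ji : j < i) v u
    (e : src X ji v = tgt X ji u) :
  exists e',
    bnd b ki (ccomp X ji v u e) = ccomp X jk (bnd b ki v) (bnd b ki u) e'.
Proof.
have e' : src X jk (bnd b ki v) = tgt X jk (bnd b ki u).
  by rewrite -[LHS]/(bnd false jk _) -[RHS]/(bnd true jk _) !bnd_bnd.
by exists e'; case: b e' => e'; [apply: tgt_comp_lower|apply: src_comp_lower].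
Qed.

End CompBoundary.

Lemma gbnd_high b m j p : m < j -> j <= p.1 -> gbnd b m p = (m, b).
Proof. by rewrite /gbnd => mj jp; rewrite leqNgt (leq_trans mj jp). Qed.

Lemma gbnd_lt b m j p : p.1 < j -> (gbnd b m p).1 < j.
Proof. by rewrite /gbnd; case: ifP => //=; lia. Qed.

Lemma gbnd_ge b m j p : j <= m -> j <= p.1 -> j <= (gbnd b m p).1.
Proof. by rewrite /gbnd; case: ifP. Qed.

Lemma gcomposable_above j m p' p : j < m -> gbnd false m p' = gbnd true m p ->
  [/\ (p'.1 < j) = (p.1 < j), (j < p'.1) = (j < p.1) & p.1 <= j -> p' = p].
Proof.
move=> jm /gcomposableP [] [h' h e]; first by rewrite e.
  by rewrite e /=; split; [lia|lia|move=> ?; lia].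
by rewrite e /=; split; [lia|lia|move=> ?; lia].
Qed.

Section Gluing.
Variables (n : enat) (X : strict_ncat n) (j k : dim n) (jk : j < k).
Variables (u v : X k) (e_vu : src X jk v = tgt X jk u).
Implicit Types (i m : dim n).
Notation D := (globe n k).

Let f := cellmap u.
Let g := cellmap v.

(** Two k-globes glued along the target j-cell of the first and the source
    j-cell of the second form a sub-n-category of the product of two globes, by
    collapsing either globe. This relation is the graph of the functor from the
    glued object to X that is f on the first globe and g on the second: a cell
    is common to both globes below dimension j, or lies in the first globe, or
    in the second, or is a composite along dimension j. The side condition in
    [GluedR] keeps the j-cell common to both globes in the first part only. *)
Variant glued i (c : X i) (a b : D i) : Prop :=
  | GluedLow of (val a).1 < j & a = b & c = f i a
  | GluedL of j <= (val a).1 & val b = (j : nat, false) & c = f i a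
  | GluedR of val a = (j : nat, true) & j <= (val b).1
      & val b <> (j : nat, false) & c = g i b
  | GluedLR (ji : j < i) e of j < (val a).1 & j < (val b).1
      & c = ccomp X ji (g i b) (f i a) e.

Lemma glued_agree_low i (a : D i) : (val a).1 < j -> f i a = g i a.
Proof.
case aE : (val a) => [l s] /= lj.
pose l' := dim_le (ltnW (ltn_trans lj jk)).
have lj' : l' < j := lj; have lk' : l' < k := ltn_trans lj jk.
rewrite /f /g /= !(@cellmap_funE _ _ _ _ _ _ l' s) // /cellmap_at.
by rewrite !(shift_gt s lk') -(bnd_bnd s true lj' jk) -(bnd_bnd s false lj' jk)
  /bnd e_vu.
Qed.

Lemma glued_agree_mid i (a b : D i) :
  val a = (j : nat, true) -> val b = (j : nat, false) -> f i a = g i b.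
Proof.
move=> aE bE; rewrite /f /g /=.
rewrite (@cellmap_funE _ _ _ _ _ _ j true) //.
rewrite (@cellmap_funE _ _ _ _ _ _ j false) //.
rewrite /cellmap_at !(shift_gt _ jk) /bnd -e_vu.
case: (dimP j i) => [h|h|h]; first by rewrite !shift_lt.
  by subst i; rewrite !shift_refl.
by case/and3P: (valP a); rewrite aE /= leqNgt h.
Qed.

Lemma glued_composable i (ji : j < i) (a b : D i) :
  j < (val a).1 -> j < (val b).1 -> src X ji (g i b) = tgt X ji (f i a).
Proof.
move=> ja jb; rewrite -nfun_src -nfun_tgt; symmetry; apply: glued_agree_mid.
  by rewrite /= /gbnd leqNgt ja.
by rewrite /= /gbnd leqNgt jb.
Qed.

(** Below dimension j all boundaries lie in the common part. In dimension j the
    source of a composite lies in the first globe and its target in the second,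
    and the source of a cell of the second globe is the j-cell common to both.
    Above dimension j a boundary stays in the part of the cell. *)
Lemma glued_bnd b0 m i (mi : m < i) c a b :
  glued c a b -> glued (bnd b0 mi c) (bnd b0 mi a) (bnd b0 mi b).
Proof.
have low (c' : X i) (a' b' : D i) : m < j -> j <= (val a').1 ->
    j <= (val b').1 -> bnd b0 mi c' = f m (bnd b0 mi a') ->
    glued (bnd b0 mi c') (bnd b0 mi a') (bnd b0 mi b').
  move=> mj ja jb cE; apply: GluedLow => //.
    by rewrite val_bnd (gbnd_high _ mj).
  by apply: val_inj; rewrite !val_bnd !(gbnd_high _ mj).
case=> [aj ab cE|ja bE cE|aE jb bN cE|ji e ja jb cE].
- subst b c; apply: GluedLow => //; last by rewrite nfun_bnd.
  by rewrite val_bnd gbnd_lt.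
- case: (leqP j m) => jm; last by apply: low => //; rewrite ?bE // cE nfun_bnd.
  apply: GluedL; last by rewrite cE nfun_bnd.
    by rewrite val_bnd gbnd_ge.
  by rewrite val_bnd bE /gbnd jm.
- have ja : j <= (val a).1 by rewrite aE.
  case: (leqP j m) => jm.
    have aE' : val (bnd b0 mi a) = (j : nat, true).
      by rewrite val_bnd aE /gbnd jm.
    have jb' : j <= (val (bnd b0 mi b)).1 by rewrite val_bnd gbnd_ge.
    case: (eqVneq (val (bnd b0 mi b)) (j : nat, false)) => [bE|/eqP bN'].
      apply: GluedL => //; first by rewrite aE'.
      by rewrite (glued_agree_mid aE' bE) cE nfun_bnd.
    by apply: GluedR => //; rewrite cE nfun_bnd.
  apply: low => //; rewrite cE -nfun_bnd.
  have -> : bnd b0 mi b = bnd b0 mi a.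
    by apply: val_inj; rewrite !val_bnd !(gbnd_high _ jm).
  by rewrite glued_agree_low // val_bnd (gbnd_high _ jm).
- case: (dimP j m) => [jm|jm|mj].
  + have [e' cE'] := bnd_comp_lower b0 jm mi e.
    rewrite -!nfun_bnd in e' cE'.
    apply: (GluedLR (ji := jm) (e := e')); last by rewrite cE cE'.
    * by rewrite val_bnd gbnd_ge.
    * by rewrite val_bnd gbnd_ge.
  + subst m; have jiE : ji = mi by apply: Prop_irrelevance.
    subst ji.
    have vE (d : D i) : j < (val d).1 -> val (bnd b0 mi d) = (j : nat, b0).
      by move=> jd; rewrite val_bnd /gbnd leqNgt jd.
    case: b0 vE low => vE _.
      apply: GluedR; rewrite ?vE //.
      by rewrite cE /bnd tgt_comp; symmetry; apply: nfun_tgt.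
    apply: GluedL; rewrite ?vE //.
    by rewrite cE /bnd src_comp; symmetry; apply: nfun_src.
  + apply: low => //; try lia.
    rewrite cE -(bnd_bnd b0 false mj ji mi) {2}/bnd src_comp.
    by rewrite [LHS](bnd_bnd b0 false) nfun_bnd.
Qed.

Lemma glued_idc m i (mi : m < i) c a b :
  glued c a b -> glued (idc X mi c) (idc D mi a) (idc D mi b).
Proof.
case=> [aj ab cE|ja bE cE|aE jb bN cE|jm e ja jb cE].
- by subst b c; apply: GluedLow => //; rewrite nfun_idc.
- by subst c; apply: GluedL; rewrite // nfun_idc.
- by subst c; apply: GluedR; rewrite // nfun_idc.
- have ji : j < i by apply: leq_trans mi; apply: ltnW.
  have e' : src X ji (g i (idc D mi b)) = tgt X ji (f i (idc D mi a)).
    rewrite !nfun_idc -(src_src jm mi) -(tgt_tgt jm mi).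
    by rewrite src_idc tgt_idc.
  apply: (GluedLR (ji := ji) (e := e')) => //.
  move: e'; rewrite !nfun_idc => e'.
  by rewrite cE; apply: idc_comp.
Qed.

Lemma glued_identity m i (mi : m < i) (c : X i) (a b : D i) : m <= j ->
    (val a).1 <= m -> (val b).1 <= m -> glued c a b ->
  [/\ c = idc X mi (src X mi c), a = idc D mi (src D mi a)
    & b = idc D mi (src D mi b)].
Proof.
move=> mj am bm.
have idE (d : D i) : (val d).1 <= m -> d = idc D mi (src D mi d).
  by move=> dm; apply: val_inj => /=; rewrite /gbnd dm.
have aE := idE _ am; have bE := idE _ bm.
case=> [aj ab cE|ja _ cE|_ jb _ cE|ji e ja jb cE]; try lia; split=> //.
- by rewrite cE -nfun_src -nfun_idc -aE.
- by rewrite cE -nfun_src -nfun_idc -aE.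
- by rewrite cE -nfun_src -nfun_idc -bE.
Qed.

(** Along a dimension m > j, composable cells have the same source and target
    in dimension j, hence lie in the same part, and for two composites the
    claim is the exchange law. Along m <= j one of the cells is an identity,
    except when a cell of the second globe follows a cell of the first one
    along m = j, which gives a composite. *)
Lemma glued_comp m i (mi : m < i) (c' c : X i) (a' a b' b : D i) e_c e_a e_b :
    glued c' a' b' -> glued c a b ->
  glued (ccomp X mi c' c e_c) (ccomp D mi a' a e_a) (ccomp D mi b' b e_b).
Proof.
move=> G' G.
have ra : gbnd false m (val a') = gbnd true m (val a) := congr1 val e_a.
have rb : gbnd false m (val b') = gbnd true m (val b) := congr1 val e_b.
case: (leqP m j) => mj; last first.
  have fE : f i (ccomp D mi a' a e_a) = ccomp X mi (f i a') (f i a)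
      (etrans (esym (nfun_src f mi a'))
        (etrans (congr1 (f m) e_a) (nfun_tgt f mi a))).
    exact: nfun_comp.
  have gE : g i (ccomp D mi b' b e_b) = ccomp X mi (g i b') (g i b)
      (etrans (esym (nfun_src g mi b'))
        (etrans (congr1 (g m) e_b) (nfun_tgt g mi b))).
    exact: nfun_comp.
  have pick (d' d : D i) e : ccomp D mi d' d e = d' \/ ccomp D mi d' d e = d.
    by case: (globe_comp_trivial e) => -[_ ->]; [right|left].
  have [aL aG aE] := gcomposable_above mj ra.
  have [bL bG bE] := gcomposable_above mj rb.
  have fst_jx (d : D i) b0 : val d = (j : nat, b0) -> (val d).1 = j.
    by move=> ->.
  case: (G') => [a'j a'b' c'E|ja' b'E c'E|a'E jb' b'N c'E|ji e' ja' jb' c'E].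
  - case: (G) => [aj ab cE|ja _ _|/fst_jx aj _ _ _|_ _ ja _ _]; try lia.
    apply: GluedLow.
    + by case: (pick _ _ e_a) => ->.
    + by apply: val_inj => /=; rewrite a'b' ab.
    + by rewrite fE; apply: ccomp_eq.
  - case: (G) => [aj _ _|ja b_E cE|_ jb bN _|_ _ _ jb _]; try lia.
    + apply: GluedL; last by rewrite fE; apply: ccomp_eq.
        by case: (pick _ _ e_a) => ->.
      by case: (pick _ _ e_b) => ->.
    + by case: bN; rewrite -bE // leqNgt -bG (fst_jx _ _ b'E) ltnn.
    + by rewrite -bG (fst_jx _ _ b'E) ltnn in jb.
  - case: (G) => [aj _ _|ja b_E cE|a_E jb bN cE|_ _ ja _ _].
    + by rewrite -aL (fst_jx _ _ a'E) ltnn in aj.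
    + by case: b'N; rewrite bE // (fst_jx _ _ b_E).
    + apply: GluedR; last by rewrite gE; apply: ccomp_eq.
      * by case: (pick _ _ e_a) => ->.
      * by case: (pick _ _ e_b) => ->.
      * by case: (pick _ _ e_b) => ->.
    + by rewrite -aG (fst_jx _ _ a'E) ltnn in ja.
  - case: (G) => [aj _ _|_ /fst_jx bj _|/fst_jx aj _ _ _|ji0 e ja jb cE];
      try lia.
    have ji0E : ji0 = ji by apply: Prop_irrelevance.
    subst ji0.
    have e3 : src X ji (g i (ccomp D mi b' b e_b)) =
              tgt X ji (f i (ccomp D mi a' a e_a)).
      apply: glued_composable; first by case: (pick _ _ e_a) => ->.
      by case: (pick _ _ e_b) => ->.
    apply: (GluedLR (ji := ji) (e := e3)).
    + by case: (pick _ _ e_a) => ->.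
    + by case: (pick _ _ e_b) => ->.
    move: e3; rewrite gE fE => e3.
    subst c c'; symmetry; exact: exchange.
have dichotomy : [\/ (val a').1 <= m /\ (val b').1 <= m,
    (val a).1 <= m /\ (val b).1 <= m |
    [/\ m = j, val a' = (j : nat, true), m < (val a).1,
        m < (val b').1 & val b = (j : nat, false)]].
  have mjE : m = j \/ m < j by case: (dimP m j); [right|left|lia].
  have ab (x : X i) (d d' : D i) : glued x d d' -> m < j ->
      ((val d).1 <= m) = ((val d').1 <= m).
    case=> [_ -> //|jd e _|e jd _ _|? _ jd jd' _] mj'.
    - by move: (val d) (val d') jd e => p p' jd -> /=; lia.
    - by move: (val d) (val d') jd e => p p' jd -> /=; lia.
    - by lia.
  case: mjE => [mE|mj']; last first.
    have := ab _ _ _ G' mj'; have := ab _ _ _ G mj'.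
    move/gcomposableP: ra => [] [h h' _] <- <-.
    - by constructor 1.
    - by constructor 1.
    - by constructor 2.
  subst m; move/gcomposableP: ra => [] [pa' pa ea].
  - by move/gcomposableP: rb => [] [pb' pb eb];
      [constructor 1|constructor 1|constructor 2].
  - by move/gcomposableP: rb => [] [pb' pb eb];
      [constructor 1|constructor 1|constructor 3].
  - move/gcomposableP: rb => [] [pb' pb eb];
      [by constructor 2| |by constructor 2].
    case: G => [? eab|_ be|ae|?]; try lia.
    + by rewrite eab in pa; lia.
    + by rewrite be /= ltnn in pb.
    + by rewrite ae in ea.
case: dichotomy => [[am bm]|[am bm]|[mE aE' am bm' bE]].
- have [cE aE bE] := glued_identity mi mj am bm G'.
  by rewrite (ccomp_unitl _ cE) (ccomp_unitl _ aE) (ccomp_unitl _ bE).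
- have [cE aE bE] := glued_identity mi mj am bm G.
  by rewrite (ccomp_unitr _ cE) (ccomp_unitr _ aE) (ccomp_unitr _ bE).
subst m.
have fc : c = f i a.
  by case: G am => // ? ? _; rewrite bE /= ltnn.
have gc : c' = g i b'.
  case: G' bm' => // [aj|_ be _|? _ aj _ _ _].
  - by rewrite aE' /= ltnn in aj.
  - by rewrite be /= ltnn.
  - by rewrite aE' /= ltnn in aj.
have aa : ccomp D mi a' a e_a = a.
  by apply: val_inj; rewrite /= /gcomp -[sval a']/(val a') aE' leqnn.
have bb : ccomp D mi b' b e_b = b'.
  by apply: val_inj; rewrite /= /gcomp -[sval b']/(val b') leqNgt bm'.
subst c c'; rewrite aa bb.
exact: (GluedLR (ji := mi) (e := e_c)).
Qed.
End Gluing.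

(** The closure properties that make the argument work inside a full
    subcategory of n-Cat. *)
Record admissible n (P : strict_ncat n -> Prop) : Prop := Admissible {
  adm_globe : forall k : dim n, P (globe n k);
  adm_flag : forall k : dim n, P (flag n k);
  adm_subprod : forall X Y S (closedS : @subprod_closed n X Y S),
    P X -> P Y -> P (subprod closedS);
  adm_dual : forall w X, P X -> P (dual w X)
}.

Section Cover.
Variables (n : enat) (X : strict_ncat n) (j k : dim n) (jk : j < k).
Variables (u v : X k) (e_vu : src X jk v = tgt X jk u).
Implicit Types (i m : dim n).
Notation D := (globe n k).

Lemma subprod_closedT (Y Z : strict_ncat n) :
  @subprod_closed n Y Z (fun _ _ _ => True).
Proof. by []. Qed.

Notation XD := (subprod (@subprod_closedT X D)).

Lemma glued_closed : @subprod_closed n XD D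
  (fun i p b => glued j u v (spl p) (spr p) b).
Proof.
split=> [b0 m i mi p b|m i mi p b|m i mi p' b' p b e e'].
- by move/(glued_bnd e_vu b0 mi); case: b0.
- exact: glued_idc.
- exact: glued_comp.
Qed.

Definition glue := subprod glued_closed.

Definition glue_proj : strict_nfunctor glue X :=
  nfunctor_comp (subprod_fst (@subprod_closedT X D)) (subprod_fst glued_closed).
Definition glue_projl : strict_nfunctor glue D :=
  nfunctor_comp (subprod_snd (@subprod_closedT X D)) (subprod_fst glued_closed).
Definition glue_projr : strict_nfunctor glue D := subprod_snd glued_closed.

(** The last property makes the composite of u and v computable from its
    images in two globes. It holds because a cell of the glued object above the
    two principal cells can only be of the composite kind. *)
Lemma glue_cover :
  exists Y : strict_ncat n, (forall P, admissible P -> P X -> P Y) /\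
  exists (q : strict_nfunctor Y X) (l r : strict_nfunctor Y D) (v' u' : Y k)
    (e : src Y jk v' = tgt Y jk u'),
  [/\ q k v' = v, q k u' = u & forall y,
     l k y = l k (ccomp Y jk v' u' e) -> r k y = r k (ccomp Y jk v' u' e) ->
     y = ccomp Y jk v' u' e].
Proof.
exists glue; split.
  move=> P admP PX; apply: adm_subprod => //; last exact: adm_globe.
  by apply: adm_subprod => //; apply: adm_globe.
exists glue_proj, glue_projl, glue_projr.
have kj : (k <= j) = false by rewrite leqNgt jk.
pose jc b := idc D jk (bnd b jk (prin k)).
have jcE b : val (jc b) = (j : nat, b).
  by case: b; rewrite /= /gbnd /= kj.
have gu : glued j u v u (prin k) (jc false).
  by apply: GluedL => //; [exact: ltnW|rewrite cellmap_prin].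
have gv : glued j u v v (jc true) (prin k).
  apply: GluedR; rewrite ?cellmap_prin //; exact: ltnW.
pose u' : glue k := SubprodCell (P := fun i (p : XD i) b =>
    glued j u v (spl p) (spr p) b)
  (spl := SubprodCell (P := fun _ _ _ => True) I) gu.
pose v' : glue k := SubprodCell (P := fun i (p : XD i) b =>
    glued j u v (spl p) (spr p) b)
  (spl := SubprodCell (P := fun _ _ _ => True) I) gv.
have e : src glue jk v' = tgt glue jk u'.
  apply: subprod_cellP; first apply: subprod_cellP; first exact: e_vu.
    by apply: val_inj; rewrite /= /gbnd /= kj /= leqnn.
  by apply: val_inj; rewrite /= /gbnd /= kj /= leqnn.
exists v', u', e; split=> // y.
have compl : glue_projl k (ccomp glue jk v' u' e) = prin k.
  by apply: val_inj; rewrite /= /gcomp /= /gbnd /= kj /= leqnn.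
have compr : glue_projr k (ccomp glue jk v' u' e) = prin k.
  by apply: val_inj; rewrite /= /gcomp /= kj.
have comp0 : glue_proj k (ccomp glue jk v' u' e) = ccomp X jk v u e_vu.
  exact: ccomp_eq.
move: (ccomp glue jk v' u' e) compl compr comp0 => w wl wr w0 yl yr.
apply: subprod_cellP; last exact: yr.
apply: subprod_cellP; last exact: yl.
rewrite [RHS]w0; rewrite wl in yl; rewrite wr in yr.
case: y yl yr => -[c a ?] b G /= aE bE; rewrite /= in G; subst a b.
case: G => [/=|_ [kj']|[kj']|ji e' _ _ ->]; try lia.
by apply: ccomp_eq; rewrite cellmap_prin.
Qed.
End Cover.

(** * Autoequivalences are duals *)

Section DualFunctor.
Variable n : enat.
Let N := nCat n.

Definition dual_functor (w : nat -> bool) : functor N N.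
Proof.
refine (@Functor N N (dual w) (@dual_fun n w) _ _).
- by move=> X; apply: strict_nfunctorP.
- by move=> X Y Z g f; apply: strict_nfunctorP.
Defined.

Lemma dual_functor_comp w w' :
  nat_isomorphic
    (functor_comp (dual_functor w) (dual_functor w'))
    (dual_functor (fun m => w m (+) w' m)).
Proof.
unshelve eapply pointwise_nat_iso.
  by exists (dual_dual w w') => X Y f; apply: strict_nfunctorP.
by move=> X; apply: bijective_is_iso => i // y; exists y.
Qed.

Lemma dual_functor_id :
  nat_isomorphic (functor_id N) (dual_functor (fun=> false)).
Proof.
unshelve eapply pointwise_nat_iso.
  by exists (@dual_id n) => X Y f; apply: strict_nfunctorP.
by move=> X; apply: bijective_is_iso => i // y; exists y.
Qed.
End DualFunctor.

Section Autoequivalences.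
Variables (n : enat) (P : strict_ncat n -> Prop) (admP : admissible P).
Implicit Types i j k l : dim n.

Let C : category := @full_subcategory (nCat n) P.
Implicit Types X Y : C.

Definition cells (X : C) : strict_ncat n := sval X.

Definition ap X Y (f : hom X Y) i (x : cells X i) : cells Y i :=
  (f : strict_nfunctor (cells X) (cells Y)) i x.

Definition globeC k : C := exist _ (globe n k) (adm_globe admP k).

Definition cellC k X (x : cells X k) : hom (globeC k) X := cellmap x.

Lemma hom_eq X Y (f g : hom X Y) :
  (forall i x, @ap X Y f i x = ap g x) -> f = g.
Proof. exact: strict_nfunctorP. Qed.

Lemma cellC_eq k X (f g : hom (globeC k) X) :
  @ap (globeC k) X f k (prin k) = ap g (prin k) -> f = g.
Proof. exact: cellmap_eq. Qed.

Lemma cellC_prin k X (x : cells X k) :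
  @ap (globeC k) X (cellC x) k (prin k) = x.
Proof. exact: cellmap_prin. Qed.

Lemma ap_comp X Y Z (g : hom Y Z) (f : hom X Y) i (x : cells X i) :
  ap (g \o f) x = ap g (ap f x).
Proof. by []. Qed.

Lemma cellC_nat k X Y (f : hom X Y) (x : cells X k) :
  f \o cellC x = cellC (ap f x).
Proof. by apply: cellC_eq; rewrite ap_comp !cellC_prin. Qed.

(** The images under F of the two maps from the k-globe to the flag differ on
    some i-cell c of F(D_k). The morphism h from G(D_i) to D_k corresponding to
    c then distinguishes the two maps, so that it hits the principal cell. *)
Lemma globe_retract_of_image (F G : functor C C) k :
  quasi_inverse F G -> exists i, retract (globeC k) (G (globeC i)).
Proof.
case=> GF FG.
pose flg : C := exist _ (flag n k) (adm_flag admP k).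
pose top : hom (globeC k) flg := flag_top n k.
pose bot : hom (globeC k) flg := flag_bot n k.
have [i [c topbot]] : exists i (c : cells (F (globeC k)) i),
    ap (fmap F top) c <> ap (fmap F bot) c.
  apply: contrapT => noc.
  have : top = bot.
    apply: (left_inverse_faithful GF); apply: hom_eq => i c.
    by apply: contrapT => tb; apply: noc; exists i, c.
  move/(congr1 (fun f : hom (globeC k) flg => val (ap f (prin k)))).
  by rewrite /= eqxx.
case: (GF) => t [s [st ts]].
have sta c : s c \o t c = idm (G (F c)) :=
  congr1 (fun u : nat_trans (functor_comp G F) (functor_comp G F) => u c) st.
pose h : hom (G (globeC i)) (globeC k) := t (globeC k) \o fmap G (cellC c).
have hE (f : hom (globeC k) flg) :
    f \o h = t flg \o fmap G (fmap F f \o cellC c).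
  have tf : f \o t (globeC k) = t flg \o fmap G (fmap F f) := ncomp_nat t f.
  by rewrite /h cmpA tf -cmpA fmapM.
have [m [d hd]] : exists m (d : cells (G (globeC i)) m),
    ap (top \o h) d <> ap (bot \o h) d.
  apply: contrapT => nod; apply: topbot.
  have : top \o h = bot \o h.
    by apply: hom_eq => m d; apply: contrapT => tb; apply: nod; exists m, d.
  rewrite !hE => /(congr1 (fun u => s flg \o u)); rewrite !cmpA !sta !cmp1m.
  move/(left_inverse_faithful FG).
  move/(congr1 (fun f : hom (globeC i) (F flg) => ap f (prin i))).
  by rewrite !ap_comp !cellC_prin.
have lev : (val (ap h d : globe n k m)).1 = k.
  apply: contrapT => lk; apply: hd; apply: val_inj; rewrite /= -/(ap h d).
  by apply/eqP.
exists i, (cellC (shift true k d)), h; apply: cellC_eq.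
rewrite ap_comp cellC_prin /ap nfun_shift -/(ap h d).
move: (ap h d : globe n k m) lev => c' lev.
have valE : val c' = (k : nat, true).
  case/and3P: (valP c'); rewrite lev eqxx implyTb => _ _.
  by case: (val c') lev => l b /= -> ->.
apply: val_inj; case: (dimP m k) => [h1|h1|h1].
- by case/and3P: (valP c'); rewrite lev leqNgt h1.
- by subst m; rewrite shift_refl valE.
- by rewrite shift_gt val_bnd valE /gbnd /= leqnn.
Qed.

(** The image of the principal cell under the idempotent s r is an iterated
    identity of some nondegenerate l-cell, whence a factorization of s r as q p
    through the l-globe with p q = 1. *)
Lemma retract_of_globe X m :
  retract X (globeC m) -> exists l, isomorphic X (globeC l).
Proof.
case=> s [r rs]; pose c : globe n m m := ap (s \o r) (prin m).
case cE : (val c) => [l b].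
have lm : l <= m by case/and3P: (valP c); rewrite cE.
pose L := dim_le lm; exists L.
pose p : hom (globeC m) (globeC L) := @cellC m (globeC L) (shift b m (prin L)).
pose q : hom (globeC L) (globeC m) := @cellC L (globeC m) (shift b L (prin m)).
have qp : q \o p = s \o r.
  apply: cellC_eq; rewrite ap_comp cellC_prin {1}/ap nfun_shift.
  rewrite -/(ap q (prin L)) cellC_prin -[RHS]/c -[RHS]globe_cellE /=.
  by rewrite (@cellmap_funE _ _ _ _ _ _ L b).
have pq : p \o q = idm (globeC L).
  apply: cellC_eq; rewrite ap_comp cellC_prin {1}/ap nfun_shift.
  by rewrite -/(ap p (prin m)) cellC_prin shift_shift.
exists (p \o s), (r \o q); split.
  by rewrite cmpA -(cmpA r) qp cmpA rs cmp1m rs.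
by rewrite -!cmpA (cmpA s) -qp -(cmpA q) pq cmpm1 pq.
Qed.

(** If j < i then every i-cell of the j-globe is an identity, and so is its
    image in the i-globe, unlike the principal cell. *)
Lemma globe_retract_le i j : retract (globeC i) (globeC j) -> i <= j.
Proof.
case=> s [r rs]; rewrite leqNgt; apply/negP => ji.
pose c : globe n j i := ap s (prin i).
have cE : c = idc _ ji (src _ ji c).
  apply: val_inj => /=; case/and3P: (valP c) => _ cj _.
  by rewrite /gbnd cj.
have : ap r c = prin i by rewrite -[RHS]/(ap (idm (globeC i)) (prin i)) -rs.
rewrite cE /ap nfun_idc => /(congr1 val)/(congr1 fst) /= h.
have := ji; rewrite ltnNge -h; case/and3P: (svalP (nfun r (src _ ji c))).
by rewrite /= => ->.
Qed.

Lemma globe_le_retract i j : i <= j -> retract (globeC i) (globeC j).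
Proof.
move=> ij; exists (@cellC i (globeC j) (shift true i (prin j))).
exists (@cellC j (globeC i) (shift true j (prin i))); apply: cellC_eq.
rewrite ap_comp cellC_prin {1}/ap nfun_shift.
rewrite -/(@ap (globeC j) (globeC i) _ j (prin j)) cellC_prin.
exact: shift_shift.
Qed.

Lemma globe_image F G i :
  quasi_inverse F G -> exists l, isomorphic (G (globeC i)) (globeC l).
Proof.
move=> qFG; have [m rm] := globe_retract_of_image i (quasi_inverse_sym qFG).
apply: (@retract_of_globe _ m); apply: (retract_trans (retract_fmap G rm)).
exact/isomorphic_retract/(quasi_inverse_iso qFG).
Qed.

(** G induces a map on dimensions that is monotone, by the retract order, and
    injective; such a map is bounded below by the identity. *)
Lemma globe_image_le F G i m :
  quasi_inverse F G -> isomorphic (G (globeC i)) (globeC m) -> i <= m.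
Proof.
move=> qFG.
have [N] := ubnP (i : nat); elim: N i m => // N IH i m iN im.
case iE : (i : nat) => [//|i0].
have i0i : i0 <= i by rewrite iE.
pose i' := dim_le i0i; have [m' im'] := globe_image i' qFG.
have i'm' : i' <= m' by apply: IH im'; rewrite /=; lia.
have m'm : m' <= m.
  apply: globe_retract_le.
  apply: (retract_trans (isomorphic_retract (isomorphic_sym im'))).
  apply: (retract_trans _ (isomorphic_retract im)).
  exact/retract_fmap/globe_le_retract.
rewrite ltn_neqAle; apply/andP; split; last exact: leq_trans i'm' m'm.
apply/eqP => i0m; have mm' : m' = m.
  by rewrite /= in i'm'; case: (dimP m' m) => //; lia.
subst m'.
have : i <= i'.
  apply: globe_retract_le; apply: isomorphic_retract.
  have FGi X : isomorphic (F (G X)) X.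
    exact: (quasi_inverse_iso (quasi_inverse_sym qFG)).
  apply: (isomorphic_trans (isomorphic_sym (FGi _))).
  apply: isomorphic_trans (FGi _); apply: isomorphic_fmap.
  exact: (isomorphic_trans im (isomorphic_sym im')).
by rewrite /= iE ltnn.
Qed.

Lemma globe_fixed F G i :
  quasi_inverse F G -> isomorphic (globeC i) (F (globeC i)).
Proof.
move=> qFG; have qGF := quasi_inverse_sym qFG.
have [m im] := globe_image i qGF; have le1 := globe_image_le qGF im.
have : isomorphic (G (globeC m)) (globeC i).
  apply: isomorphic_trans (quasi_inverse_iso qFG _).
  exact/isomorphic_fmap/isomorphic_sym.
move/(globe_image_le qFG) => le2.
have mi : m = i by apply: val_inj; apply/eqP; rewrite eqn_leq le1 le2.
by subst m; apply: isomorphic_sym.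
Qed.

(** k-cells of F(X) are morphisms from D_k, hence from F(D_k), to F(X), and
    these are morphisms from D_k to X because F is fully faithful. *)
Lemma natural_cells F G : quasi_inverse F G ->
  exists theta : forall i X, cells X i -> cells (F X) i,
  [/\ forall i X Y (f : hom X Y) x,
        theta i Y (ap f x) = ap (fmap F f) (theta i X x),
      forall i X, injective (@theta i X) &
      forall i X y, exists x, @theta i X x = y].
Proof.
move=> qFG; pose ex_phi i := cid (globe_fixed i qFG).
pose phi i := sval (ex_phi i).
have isophi i : is_iso (phi i) := svalP (ex_phi i).
exists (fun i X x => ap (fmap F (cellC x)) (ap (phi i) (prin i))); split.
- by move=> i X Y f x; rewrite -cellC_nat fmapM.
- move=> i X x y /= exy; have [psi [_ phipsi]] := isophi i.
  have : fmap F (cellC x) \o phi i = fmap F (cellC y) \o phi i.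
    exact: cellC_eq.
  move/(congr1 (fun u => u \o psi)); rewrite -!cmpA phipsi !cmpm1.
  move/(left_inverse_faithful qFG.1) => e.
  by rewrite -(cellC_prin x) e cellC_prin.
- move=> i X y; have [psi [psiphi _]] := isophi i.
  have [f fE] := equivalence_full qFG.1 qFG.2 (cellC y \o psi).
  exists (ap f (prin i)); rewrite -cellC_nat.
  have -> : @cellC i (globeC i) (prin i) = idm (globeC i).
    by apply: cellC_eq; rewrite cellC_prin.
  rewrite cmpm1 fE -[LHS]/(ap ((cellC y \o psi) \o phi i) (prin i)).
  by rewrite -cmpA psiphi cmpm1 cellC_prin.
Qed.

Lemma ap_bnd X Y (f : hom X Y) b j i (ji : j < i) (x : cells X i) :
  ap f (bnd b ji x) = bnd b ji (ap f x).
Proof. exact: nfun_bnd. Qed.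

Lemma ap_ccomp X Y (f : hom X Y) j i (ji : j < i) (v u : cells X i) e :
  exists e',
    ap f (ccomp (cells X) ji v u e) = ccomp (cells Y) ji (ap f v) (ap f u) e'.
Proof.
have e' : src (cells Y) ji (ap f v) = tgt (cells Y) ji (ap f u).
  by rewrite -[LHS](ap_bnd f false) -[RHS](ap_bnd f true) /bnd e.
by exists e'; apply: nfun_comp.
Qed.

Section Untwisted.
Variables (H : functor C C) (theta : forall i X, cells X i -> cells (H X) i).
Hypothesis theta_nat : forall i X Y (f : hom X Y) x,
  theta (ap f x) = ap (fmap H f) (@theta i X x).
Hypothesis theta_inj : forall i X, injective (@theta i X).
Hypothesis theta_sur : forall i X y, exists x, @theta i X x = y.
Hypothesis theta_bnd : forall b j i (ji : j < i) X (x : cells X i),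
  theta (bnd b ji x) = bnd b ji (theta x).

(** By naturality it is enough to consider the principal cell of the j-globe,
    and there an i-cell with that cell as target can only be its identity. *)
Lemma theta_idc j i (ji : j < i) X (x : cells X j) :
  theta (idc (cells X) ji x) = idc (cells (H X)) ji (theta x).
Proof.
have [w wE] :=
  theta_sur (idc (cells (H (globeC j))) ji (@theta j (globeC j) (prin j))).
have w_idc : w = idc (cells (globeC j)) ji (prin j).
  have : bnd true ji w = prin j.
    by apply: (@theta_inj j (globeC j)); rewrite theta_bnd wE bnd_idc.
  move/(congr1 val); rewrite val_bnd => wb; apply: val_inj.
  rewrite -[RHS]/(val (prin j)) -wb /gbnd.
  by case/and3P: (valP (w : globe n j i)) => _ ->.
rewrite -{2}(cellC_prin x) theta_nat -[RHS](nfun_idc (fmap H (cellC x))) -wE.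
rewrite -[RHS]/(ap (fmap H (cellC x)) (theta w)) -theta_nat w_idc.
rewrite [ap _ _]nfun_idc.
by rewrite -[nfun _ _]/(ap (cellC x) (prin j : cells (globeC j) j)) cellC_prin.
Qed.

Lemma theta_composable j i (ji : j < i) X (v u : cells X i) :
  src _ ji v = tgt _ ji u ->
  src (cells (H X)) ji (theta v) = tgt _ ji (theta u).
Proof.
by move=> e; rewrite -[LHS](theta_bnd false) -[RHS](theta_bnd true) /bnd e.
Qed.

Lemma theta_comp_globe j i (ji : j < i) k (v u : cells (globeC k) i) e e' :
  theta (ccomp (cells (globeC k)) ji v u e) =
  ccomp (cells (H (globeC k))) ji (theta v) (theta u) e'.
Proof.
case: (globe_comp_trivial e) => -[idE ->].
  have vE : theta v = idc (cells (H (globeC k))) ji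
      (theta (src (cells (globeC k)) ji v)) by rewrite -theta_idc -idE.
  by rewrite (ccomp_unitl _ vE).
have uE : theta u = idc (cells (H (globeC k))) ji
    (theta (src (cells (globeC k)) ji u)) by rewrite -theta_idc -idE.
by rewrite (ccomp_unitr _ uE).
Qed.

(** The composite of the transported lifts is theta w for some cell w of the
    cover Y. The projections of w to the globes are those of the composite of
    the lifts, by the case of globes, so w is that composite. *)
Lemma theta_comp j i (ji : j < i) X (v u : cells X i) e e' :
  theta (ccomp (cells X) ji v u e) =
  ccomp (cells (H X)) ji (theta v) (theta u) e'.
Proof.
have [Y0 [PY [q0 [l [r [v' [u' [eY [v'E u'E sep]]]]]]]]] := glue_cover e.
pose Y : C := exist _ Y0 (PY P admP (svalP X)).
have eH := @theta_composable j i ji Y v' u' eY.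
have [w wE] :=
  theta_sur (ccomp (cells (H Y)) ji (@theta i Y v') (@theta i Y u') eH).
have proj_w (q : hom Y (globeC i)) :
    ap q w = ap q (ccomp (cells Y) ji v' u' eY).
  apply: theta_inj; rewrite theta_nat wE.
  have [e1 ->] := ap_ccomp (fmap H q) eH.
  have [e2 ->] := @ap_ccomp Y (globeC i) q _ _ _ _ _ eY.
  rewrite (theta_comp_globe _ (theta_composable e2)).
  by apply: ccomp_eq; rewrite theta_nat.
have w_comp : w = ccomp Y0 ji v' u' eY by apply: sep; apply: proj_w.
pose q : hom Y X := q0.
have -> : ccomp (cells X) ji v u e = ap q w.
  rewrite w_comp; have [e1 ->] := @ap_ccomp Y X q _ _ _ _ _ eY.
  by apply: ccomp_eq; [rewrite -[LHS]v'E|rewrite -[LHS]u'E].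
rewrite theta_nat wE; have [e1 ->] := ap_ccomp (fmap H q) eH.
by apply: ccomp_eq; rewrite -theta_nat; congr theta.
Qed.

Definition untwisted_map X : hom X (H X).
Proof.
refine (@StrictNFunctor n (cells X) (cells (H X)) (fun i => @theta i X)
  _ _ _ _).
- by move=> j i ji u; apply: (theta_bnd false).
- by move=> j i ji u; apply: (theta_bnd true).
- by move=> j i ji x; apply: theta_idc.
- by move=> *; apply: theta_comp.
Defined.

Lemma untwisted_iso : nat_isomorphic (functor_id C) H.
Proof.
unshelve eapply pointwise_nat_iso.
  exists untwisted_map => X Y f; apply: hom_eq => i x.
  by rewrite !ap_comp; symmetry; apply: theta_nat.
move=> X; apply: (@bijective_is_iso n _ _ (untwisted_map X)) => i.
  exact: theta_inj.
exact: theta_sur.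
Qed.
End Untwisted.

Lemma dualP w (X : nCat n) : P X -> P (dual_functor n w X).
Proof. exact: adm_dual. Qed.

Definition dualC w : functor C C := restrict (@dualP w).

Lemma dualC_comp w w' :
  nat_isomorphic (functor_comp (dualC w) (dualC w'))
    (dualC (fun m => w m (+) w' m)).
Proof.
have PDD (X : nCat n) :
    P X -> P (functor_comp (dual_functor n w) (dual_functor n w') X).
  by move=> PX; apply: dualP (dualP _ PX).
apply: (isomorphic_trans (restrict_comp _ _ PDD)).
exact/restrict_iso/dual_functor_comp.
Qed.

Lemma dualC_id :
  nat_isomorphic (functor_id C) (dualC (fun=> false)).
Proof.
apply: (isomorphic_trans (restrict_id (fun (X : nCat n) (PX : P X) => PX))).
exact/restrict_iso/dual_functor_id.
Qed.

Section Twist.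
Variables (F G : functor C C) (qFG : quasi_inverse F G).
Variable theta : forall i X, cells X i -> cells (F X) i.
Hypothesis theta_nat : forall i X Y (f : hom X Y) x,
  theta (ap f x) = ap (fmap F f) (@theta i X x).
Hypothesis theta_sur : forall i X y, exists x, @theta i X x = y.
Hypothesis theta_inj : forall i X, injective (@theta i X).

(** By naturality the transported boundary operation is given by a j-cell c of
    the i-globe, an iterated identity of some nondegenerate l-cell. It has to
    be shown that l = j. *)
Lemma boundary_image b j i (ji : j < i) :
  exists b', forall X (x : cells X i),
    bnd b ji (theta x) = theta (bnd b' ji x).
Proof.
have [c cE] := theta_sur (bnd b ji (@theta i (globeC i) (prin i))).
have thE X (x : cells X i) : bnd b ji (theta x) = theta (ap (cellC x) c).
  by rewrite theta_nat cE ap_bnd -theta_nat cellC_prin.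
case valE : (val (c : globe n i j)) => [l s].
have [lj li] : l <= j /\ l <= i.
  by case/and3P: (valP (c : globe n i j)); rewrite valE.
pose L := dim_le li.
have cellE X (x : cells X i) : ap (cellC x) c = shift s j (shift s L x).
  by rewrite /ap /= (@cellmap_funE _ _ _ _ _ _ L s).
case: (dimP L j) => [Lj|Lj|]; last by rewrite /= ltnNge lj.
  (* Every j-cell is the boundary of its own identity, so the operation given
     by c hits prin j, which it cannot do if it factors through dimension l. *)
  have [z zE] :=
    theta_sur (idc (cells (F (globeC j))) ji (@theta j (globeC j) (prin j))).
  have : bnd b ji (theta z) = theta (prin j : cells (globeC j) j).
    by rewrite zE bnd_idc.
  rewrite thE => /theta_inj; rewrite cellE (shift_lt _ Lj).
  move: (shift s L z : globe n j L) => y.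
  move/(congr1 (fun d : globe n j j => (val d).1)).
  case/and3P: (valP y) => yL _ _ yj; move: yL.
  rewrite -[(val y).1]/((val (idc (globe n j) Lj y)).1) yj /=.
  by rewrite leqNgt (Lj : l < j).
exists s => X x; rewrite thE cellE; congr theta; subst j.
by rewrite shift_refl shift_gt.
Qed.

(** If source and target were transported to the same operation, then source
    and target would agree on F(X) for all X, while every globe is isomorphic
    to such an F(X). *)
Lemma boundary_twist_at j i (ji : j < i) :
  exists t, forall b X (x : cells X i),
    bnd b ji (theta x) = theta (bnd (b (+) t) ji x).
Proof.
have [t tE] := boundary_image false ji; have [t' t'E] := boundary_image true ji.
case: (eqVneq t' (~~ t)) => [t'N|tt'].
  by exists t => -[] X x; rewrite ?tE ?t'E ?t'N.
have {tt'} tt' : t' = t by case: t t' tt' {tE t'E} => -[].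
subst t'; exfalso.
have FG i' : isomorphic (F (G (globeC i'))) (globeC i').
  exact: (quasi_inverse_iso (quasi_inverse_sym qFG)).
have [f [g [_ fg]]] := FG i.
have [x xE] := theta_sur (ap g (prin i)).
have : bnd false ji (ap f (theta x)) = bnd true ji (ap f (theta x)).
  by rewrite -!ap_bnd tE t'E.
rewrite xE -ap_comp fg -[ap _ _]/(prin i : globe n i i).
by move/(congr1 val); rewrite !val_bnd /gbnd /= leqNgt ji.
Qed.

(** The j-boundary of an i-cell is the j-boundary of its target in dimension
    j + 1, so the bit found in dimension j + 1 serves for every i > j. It is
    set to false when j + 1 exceeds n, which makes w unique. *)
Lemma boundary_twist : exists w : nat -> bool,
  (forall m, ~~ enat_ge n m.+1 -> w m = false) /\
  forall b j i (ji : j < i) X (x : cells X i),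
    bnd b ji (theta x) = theta (bnd (b (+) w j) ji x).
Proof.
have bit (m : nat) : exists t : bool, (~~ enat_ge n m.+1 -> t = false) /\
    forall b j i (ji : j < i) X (x : cells X i), j = m :> nat ->
      bnd b ji (theta x) = theta (bnd (b (+) t) ji x).
  case: (boolP (enat_ge n m.+1)) => [mn|mn]; last first.
    exists false; split=> // b j i ji X x jm; exfalso; move/negP: mn; apply.
    by apply: (@dim_le_proof n i); rewrite -jm.
  pose m1 : dim n := exist _ m.+1 mn.
  pose m0 : dim n := @dim_le n m1 m (leqnSn m).
  have m01 : m0 < m1 by [].
  have [t tE] := boundary_twist_at m01; exists t; split=> // b j i ji X x jm.
  have jm0 : j = m0 by apply: val_inj.
  subst j; case: (dimP m1 i) => [m1i|m1i|]; last by rewrite /= ltnNge -[m]jm ji.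
    have [t' t'E] := boundary_twist_at m1i.
    (* x is replaced by its boundary in dimension j + 1 whose image is the
       target of theta x. *)
    rewrite -(bnd_bnd b true m01 m1i ji) -[true](addbK t').
    by rewrite t'E tE !bnd_bnd.
  by subst i; rewrite (_ : ji = m01) // ; apply: Prop_irrelevance.
have [w wE] := choice bit; exists w; split=> [m|b j i ji X x].
  by case: (wE m).
by case: (wE j) => _; apply.
Qed.
End Twist.

(** With the bits w given by [boundary_twist], the functor [dual w] o F is
    isomorphic to the identity; and [dual w] is its own inverse. *)
Theorem autoequivalence_dual F G : quasi_inverse F G ->
  exists w, (forall m, ~~ enat_ge n m.+1 -> w m = false) /\
    nat_isomorphic F (dualC w).
Proof.
move=> qFG; have [theta [theta_nat theta_inj theta_sur]] := natural_cells qFG.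
have [w [w0 wE]] := boundary_twist qFG theta_nat theta_sur theta_inj.
exists w; split=> //.
have : nat_isomorphic (functor_id C) (functor_comp (dualC w) F).
  apply: (@untwisted_iso (functor_comp (dualC w) F) theta) => //.
  by move=> b j i ji X x; rewrite bnd_dual wE addbK.
set D := dualC w => idDF.
have DD : @isomorphic (endofunctors C) (tens (D : endofunctors C) D) munit.
  apply: (isomorphic_trans (dualC_comp w w)); apply: isomorphic_sym.
  have -> : (fun m => w m (+) w m) = (fun=> false).
    by apply/funext => m; apply: addbb.
  exact: dualC_id.
pose F' : endofunctors C := F; pose D' : endofunctors C := D.
apply: (@isomorphic_trans (endofunctors C) F' (tens munit F')).
  by apply: isomorphic_sym; exists (munitl F'); apply: munitl_iso.
apply: (@isomorphic_trans (endofunctors C) _ (tens (tens D' D') F')).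
  by apply: isomorphic_tens; [apply: isomorphic_sym|apply: isomorphic_refl].
apply: (@isomorphic_trans (endofunctors C) _ (tens D' (tens D' F'))).
  by exists (massoc _ _ _); apply: massoc_iso.
apply: (@isomorphic_trans (endofunctors C) _ (tens D' munit)).
  by apply: isomorphic_tens; [apply: isomorphic_refl|apply: isomorphic_sym].
by exists (munitr D'); apply: munitr_iso.
Qed.

Section DualHom.
Variables (w w' : nat -> bool) (t : nat_trans (dualC w) (dualC w')).

Let tx i X (x : cells X i) : cells X i :=
  @ap (dualC w X) (dualC w' X) (t X) i x.

Lemma dual_hom_nat i X Y (f : hom X Y) (x : cells X i) :
  ap f (tx x) = tx (ap f x).
Proof.
have tf : fmap (dualC w') f \o t X = t Y \o fmap (dualC w) f := ncomp_nat t f.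
exact: (congr1 (fun h => @ap (dualC w X) (dualC w' Y) h i x) tf).
Qed.

Lemma dual_hom_bnd b j i (ji : j < i) X (x : cells X i) :
  bnd (b (+) w' j) ji (tx x) = tx (bnd (b (+) w j) ji x).
Proof.
rewrite -(@bnd_dual _ w' b (cells X)) -(@bnd_dual _ w b (cells X)).
by rewrite /tx (@ap_bnd (dualC w X) (dualC w' X) (t X) b).
Qed.

(** By induction the boundary of the image c of the principal i-cell is known:
    its source and target in dimension i - 1 are distinct, so c is
    nondegenerate, hence principal; comparing the sources yields the equality
    of the bits. *)
Lemma dual_hom_id i : (forall X (x : cells X i), tx x = x) /\
  (forall j : dim n, i = j.+1 :> nat -> w j = w' j).
Proof.
have [N] := ubnP (i : nat); elim: N i => // N IH i iN.
pose c : globe n i i := @tx i (globeC i) (prin i).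
have cbnd b j (ji : j < i) : gbnd (b (+) w' j) j (val c) = (j : nat, b (+) w j).
  rewrite -val_bnd [bnd _ _ _](@dual_hom_bnd b j i ji (globeC i) (prin i)).
  rewrite (IH j _).1; last by lia.
  by rewrite val_bnd /gbnd /= leqNgt ji.
have cE : c = prin i.
  have lev : (val c).1 = i.
    apply/eqP; rewrite eqn_leq; case/and3P: (valP c) => -> _ _ /=.
    case: (posnP i) => [i0|ipos].
      by apply: leq_trans (leq0n _); rewrite i0.
    pose j' := dim_le (leq_pred i); have ji : j' < i by rewrite /= ltn_predL.
    rewrite leqNgt; apply/negP => ci.
    have cj : (val c).1 <= j' by rewrite /= -ltnS prednK.
    have := cbnd true j' ji.
    have := cbnd false j' ji; rewrite /gbnd cj => -> [].
    by case: (w j').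
  apply: val_inj; case/and3P: (valP c); rewrite lev eqxx implyTb => _ _ c2.
  by case: (val c) lev c2 => l s /= -> ->.
split=> [X x|j ij].
  by rewrite -{1}(cellC_prin x) -dual_hom_nat -/c cE cellC_prin.
have ji : j < i by rewrite ij.
by have := cbnd false j ji; rewrite cE /gbnd /= leqNgt ji => -[].
Qed.
End DualHom.
End Autoequivalences.

(** * Monoidal categories of autoequivalences that are discrete *)

Section Criterion.
Variables (C : category) (Z : zmodType) (op : Z -> functor C C).
Notation "F ~ G" := (nat_isomorphic F G) (at level 70).

Hypothesis op0 : functor_id C ~ op 0%R.
Hypothesis opD : forall x y, functor_comp (op x) (op y) ~ op (x + y)%R.
Hypothesis op_total : forall F : functor C C, is_equivalence F ->
  exists x, F ~ op x.
Hypothesis op_discrete : forall x y, nat_trans (op x) (op y) -> x = y.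
Hypothesis op_rigid : forall x (t t' : nat_trans (op x) (op x)), t = t'.

Lemma op_hom_irr x y (t t' : nat_trans (op x) (op y)) : t = t'.
Proof. by have xy := op_discrete t; subst y; apply: op_rigid. Qed.

Lemma op_inverse x : functor_comp (op (- x)%R) (op x) ~ functor_id C.
Proof.
apply: (isomorphic_trans (opD _ _)); rewrite GRing.addNr.
exact: isomorphic_sym op0.
Qed.

Lemma op_equivalence x : is_equivalence (op x).
Proof.
exists (op (- x)%R); split; first exact: op_inverse.
by rewrite -{1}[x]GRing.opprK; apply: op_inverse.
Qed.

Let A := Aut C.

Lemma aut_total (F : A) : exists x, sval F ~ op x.
Proof. by case: F => F eF; apply: op_total. Qed.

Definition aut_index (F : A) : Z := sval (cid (aut_total F)).

Lemma aut_indexP (F : A) : sval F ~ op (aut_index F).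
Proof. by rewrite /aut_index; case: cid. Qed.

Lemma aut_hom_irr (F G : A) (t t' : hom F G) : t = t'.
Proof.
have [f [f' [f'f _]]] := aut_indexP F; have [g [g' [g'g _]]] := aut_indexP G.
have e : nat_cmp g (nat_cmp t f') = nat_cmp g (nat_cmp t' f') := op_hom_irr _ _.
pose E := functor_category C C.
have can (u : @hom E (sval F) (sval G)) :
    u = (g' \o ((g \o (u \o f')) \o f)) :> @hom E _ _.
  by rewrite -!cmpA f'f cmpm1 cmpA g'g cmp1m.
rewrite (can t) (can t').
by congr (g' \o (_ \o f)).
Qed.

Lemma aut_index_hom (F G : A) : hom F G -> aut_index F = aut_index G.
Proof.
move=> t; have [f [f' _]] := aut_indexP F; have [g _] := aut_indexP G.
by apply: op_discrete; exact: nat_cmp g (nat_cmp t f').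
Qed.

Lemma aut_index_iso (F : A) x : sval F ~ op x -> aut_index F = x.
Proof.
have [f [f' _]] := aut_indexP F; case=> g _.
by apply: op_discrete; exact: nat_cmp g f'.
Qed.

Lemma aut_isomorphic (F G : A) : sval F ~ sval G -> isomorphic F G.
Proof. by case=> f [g fg]; exists f, g. Qed.

Definition aut_index_functor : functor A (disc Z).
Proof.
refine (@Functor A (disc Z) aut_index aut_index_hom _ _).
all: by intros; apply: discrete_hom_irr.
Defined.

Lemma aut_indexD (F G : A) :
  (aut_index F + aut_index G)%R = aut_index (tens F G).
Proof.
symmetry; apply: aut_index_iso; apply: isomorphic_trans (opD _ _).
by apply: (@isomorphic_tens (endofunctors C)); apply: aut_indexP.
Qed.

Lemma aut_index1 : 0%R = aut_index (munit : A).
Proof. by symmetry; apply: aut_index_iso. Qed.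

Definition aut_index_monoidal : strong_monoidal_functor A (disc Z).
Proof.
refine (@StrongMonoidalFunctor A (disc Z) aut_index_functor
  aut_indexD aut_index1 _ _ _ _ _ _).
all: by intros; first [exact: discrete_is_iso | exact: discrete_hom_irr].
Defined.

Definition op_functor : functor (disc Z) A.
Proof.
refine (@Functor (disc Z) A (fun x => exist _ (op x) (op_equivalence x))
  (fun x y (e : x = y) => ecast z (nat_trans (op x) (op z)) e (nat_id (op x)))
  _ _).
all: by intros; apply: aut_hom_irr.
Defined.

(** Both categories have at most one morphism between two objects, so every
    coherence and naturality condition is automatic. *)
Theorem aut_discrete : monoidally_equivalent A (disc Z).
Proof.
exists aut_index_monoidal, op_functor; split.
  have iso F : isomorphic (functor_comp op_functor aut_index_functor F) F.
    by apply: aut_isomorphic; apply: isomorphic_sym; apply: aut_indexP.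
  unshelve eapply pointwise_nat_iso.
    exists (fun F => sval (cid (iso F))) => F G t; exact: aut_hom_irr.
  by move=> F; apply: svalP (cid (iso F)).
have eq x : hom (functor_comp aut_index_functor op_functor x) x.
  by apply: aut_index_iso; apply: isomorphic_refl.
unshelve eapply pointwise_nat_iso.
  exists eq => x y e; exact: discrete_hom_irr.
by move=> x; apply: discrete_is_iso.
Qed.
End Criterion.

(** * The autoequivalences of n-Cat and of rigid n-categories *)

Section Main.
Variable n : enat.

(** The shift of index reflects that reversing the cells of dimension m + 1
    exchanges sources and targets in dimension m. *)
Definition dual_bits (x : Z2pow n) (m : nat) : bool :=
  if insub m.+1 is Some k then x k == 1%R else false.

Lemma Z2_add (a b : 'Z_2) : (a + b == 1)%R = (a == 1%R) (+) (b == 1%R).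
Proof. by case: a b => -[|[|//]] ? [[|[|//]] ?]. Qed.

Lemma Z2_eq (a b : 'Z_2) : (a == 1%R) = (b == 1%R) -> a = b.
Proof. by case: a b => -[|[|//]] ? [[|[|//]] ?] //= _; apply: val_inj. Qed.

Lemma dual_bits0 : dual_bits 0%R = (fun=> false).
Proof. by apply/funext => m; rewrite /dual_bits; case: insubP. Qed.

Lemma dual_bitsD x y :
  dual_bits (x + y)%R = (fun m => dual_bits x m (+) dual_bits y m).
Proof.
apply/funext => m; rewrite /dual_bits; case: insubP => // k _ _.
exact: Z2_add.
Qed.

Lemma dual_bits_surj (w : nat -> bool) :
  (forall m, ~~ enat_ge n m.+1 -> w m = false) -> exists x, dual_bits x = w.
Proof.
move=> w0; exists (fun k => if w (val k).-1 then 1%R else 0%R).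
apply/funext => m; rewrite /dual_bits; case: insubP => [k _ -> /=|/w0 //].
by case: (w m).
Qed.

Lemma dual_bits_inj x y :
  (forall i j : dim n, i = j.+1 :> nat -> dual_bits x j = dual_bits y j) ->
  x = y.
Proof.
move=> xy; apply/funext => k; apply: Z2_eq.
have [k0 kn] := andP (valP k).
pose i : dim n := exist _ (val k) kn.
pose j := @dim_le n i _ (leq_pred (val k)).
have ij : i = j.+1 :> nat by rewrite /= prednK.
by have := xy i j ij; rewrite /dual_bits -ij /= valK.
Qed.

Section Full.
Variables (P : strict_ncat n -> Prop) (admP : admissible P).
Let C : category := @full_subcategory (nCat n) P.

Lemma dualC_discrete x y :
  nat_trans (dualC admP (dual_bits x)) (dualC admP (dual_bits y)) -> x = y.
Proof. by move=> t; apply: dual_bits_inj => i; apply: (dual_hom_id t i).2. Qed.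

Lemma dualC_hom_irr x
    (t t' : nat_trans (dualC admP (dual_bits x)) (dualC admP (dual_bits x))) :
  t = t'.
Proof.
apply: nat_transP => X; apply: strict_nfunctorP => i u.
exact: etrans ((dual_hom_id t i).1 X u) (esym ((dual_hom_id t' i).1 X u)).
Qed.

Lemma dualC_total (F : functor C C) : is_equivalence F ->
  exists x, nat_isomorphic F (dualC admP (dual_bits x)).
Proof.
case=> G FG.
have [w [/dual_bits_surj [x <-] Fw]] := autoequivalence_dual admP FG.
by exists x.
Qed.

Lemma aut_full : monoidally_equivalent (Aut C) (disc (Z2pow n)).
Proof.
apply: (aut_discrete (op := fun x => dualC admP (dual_bits x))).
- by rewrite dual_bits0; apply: dualC_id.
- by move=> x y; rewrite dual_bitsD; apply: dualC_comp.
- exact: dualC_total.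
- exact: dualC_discrete.
- exact: dualC_hom_irr.
Qed.
End Full.

Lemma admissible_true : admissible (fun _ : strict_ncat n => True).
Proof. by []. Qed.

Lemma admissible_rigid : admissible (@rigid n).
Proof.
split; [move=> k; exact: globe_rigid|move=> k; exact: flag_rigid| |].
  by move=> X Y S closedS; apply: subprod_rigid.
by move=> w X; apply: dual_rigid.
Qed.

Definition restrict_dual_hom w w'
    (t : nat_trans (dual_functor n w) (dual_functor n w')) :
  nat_trans (dualC admissible_true w) (dualC admissible_true w').
Proof.
by exists (fun X => t (sval X)) => X Y f; apply: (ncomp_nat t f).
Defined.

(** The category n-Cat is not literally a full subcategory of itself; an
    autoequivalence is moved to the full subcategory on all objects, and the
    resulting isomorphism is moved back. *)
Lemma aut_ncat : monoidally_equivalent (Aut (nCat n)) (disc (Z2pow n)).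
Proof.
apply: (aut_discrete (op := fun x => dual_functor n (dual_bits x))).
- by rewrite dual_bits0; apply: dual_functor_id.
- by move=> x y; rewrite dual_bitsD; apply: dual_functor_comp.
- move=> F [G [GF FG]].
  pose T (X : nCat n) := True.
  pose r H := @restrict _ T H (fun _ _ => I); pose rF := r F; pose rG := r G.
  have rI : nat_isomorphic (r (functor_id (nCat n))) (functor_id _).
    by apply: isomorphic_sym; apply: restrict_id.
  have [|x xE] := @dualC_total _ admissible_true rF.
    exists rG; split.
      apply: (isomorphic_trans (restrict_comp _ _ (fun _ _ => I))).
      exact: isomorphic_trans (restrict_iso _ _ GF) rI.
    apply: (isomorphic_trans (restrict_comp _ _ (fun _ _ => I))).
    exact: isomorphic_trans (restrict_iso _ _ FG) rI.
  exists x; exact: (@unrestrict_iso (nCat n) T _ _ _ _ (fun=> I) xE).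
- by move=> x y /restrict_dual_hom; apply: dualC_discrete.
- move=> x t t'; apply: nat_transP => X.
  have := dualC_hom_irr (restrict_dual_hom t) (restrict_dual_hom t').
  move/(congr1 (fun u : nat_trans (dualC _ _) (dualC _ _) => u (exist _ X I))).
  exact.
Qed.
End Main.

Theorem theorem4p5p6 (n : enat) :
  monoidally_equivalent (Aut (nCat n)) (disc (Z2pow n)) /\
  monoidally_equivalent (Aut (nCat_r n)) (disc (Z2pow n)).
Proof. by split; [apply: aut_ncat | apply: aut_full (@admissible_rigid n)]. Qed.
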